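(* Up to isometries of $\mathbf R^{1,1}$ fixing the origin, the space-like curves $X$, other than straight lines, which contract under the mean curvature flow with scaling function $\sqrt{1-2t}$, $t<\frac12$, form a one-parameter family. Each such curve is convex, asymptotic to a cone, symmetric with respect to the $y$-axis, and $k^2e^{-\langle X,X\rangle}$ is constant along it. Under the flow it comes from infinity as $t\to-\infty$ and contracts to the union of the positive $\xi$-axis and the negative $\eta$-axis as $t\to\frac12$.
   Context: $\mathbf R^{1,1}$ is $\mathbf R^2$ with $\langle (x_1,y_1),(x_2,y_2)\rangle = x_1x_2-y_1y_2$; points $x+hy$, $h^2=1$. Light-like coordinates $\xi = x+y$, $\eta = x-y$; the positive $\xi$-axis is $\{\eta=0,\xi>0\}$ and the negative $\eta$-axis is $\{\xi=0,\eta<0\}$. For a space-like curve, $s$ is Minkowski arc-length, $T=X_s$, $N=hT$, $T_s=kN$; convex means $k$ has a fixed strict sign. Mean curvature flow: $\langle\partial_tX,N\rangle=-k$. Contracting with scaling function $\sqrt{1-2t}$ means $\sqrt{1-2t}\,X$ solves the flow, equivalently $\langle X,N\rangle = k$. *)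

(* Defs.v *)
From Stdlib Require Import Reals.
From Coquelicot Require Import Coquelicot.
Open Scope R_scope.

(** Points of R^{1,1} = R^2; the point x + h y is the pair (x, y). *)
Definition pt := (R * R)%type.

Definition mink (p q : pt) : R := fst p * fst q - snd p * snd q.

(** Multiplication by h (h^2 = 1): h (x + h y) = y + h x. *)
Definition hmul (p : pt) : pt := (snd p, fst p).

Definition xi (p : pt) : R := fst p + snd p.
Definition eta (p : pt) : R := fst p - snd p.

Definition padd (p q : pt) : pt := (fst p + fst q, snd p + snd q).
Definition psub (p q : pt) : pt := (fst p - fst q, snd p - snd q).
Definition pscal (c : R) (p : pt) : pt := (c * fst p, c * snd p).

(** Euclidean norm on R^2 (used only for the topological notions:
    going to infinity, asymptotics, set convergence). *)
Definition enorm (p : pt) : R := sqrt (fst p ^ 2 + snd p ^ 2).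

Definition in_ivl (l r : Rbar) (s : R) : Prop := Rbar_lt l s /\ Rbar_lt s r.

Definition dcurve (X : R -> pt) (s : R) : pt :=
  (Derive (fun t => fst (X t)) s, Derive (fun t => snd (X t)) s).

(** T = X_s, N = h T, and the curvature k defined by T_s = k N
    (for an arc-length parametrized space-like curve T_s is orthogonal to T,
     hence a multiple of N, and <N,N> = -1 gives k = - <T_s, N>). *)
Definition tangent (X : R -> pt) (s : R) : pt := dcurve X s.
Definition normal (X : R -> pt) (s : R) : pt := hmul (tangent X s).
Definition curvature (X : R -> pt) (s : R) : R :=
  - mink (dcurve (tangent X) s) (normal X s).

Definition C2_on (X : R -> pt) (l r : Rbar) : Prop :=
  forall s, in_ivl l r s ->
    ex_derive (fun t => fst (X t)) s /\ ex_derive (fun t => snd (X t)) s /\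
    ex_derive (fun t => fst (tangent X t)) s /\
    ex_derive (fun t => snd (tangent X t)) s.

Definition spacelike_arclength (X : R -> pt) (l r : Rbar) : Prop :=
  Rbar_lt l r /\ C2_on X l r /\
  forall s, in_ivl l r s -> mink (tangent X s) (tangent X s) = 1.

(** Contracting under MCF with scaling function sqrt(1-2t):
    equivalently <X, N> = k. *)
Definition shrinker (X : R -> pt) (l r : Rbar) : Prop :=
  spacelike_arclength X l r /\
  forall s, in_ivl l r s -> mink (X s) (normal X s) = curvature X s.

Definition max_shrinker (X : R -> pt) (l r : Rbar) : Prop :=
  shrinker X l r /\
  forall (Y : R -> pt) (l' r' : Rbar), shrinker Y l' r' ->
    Rbar_le l' l -> Rbar_le r r' ->
    (forall s, in_ivl l r s -> Y s = X s) -> l' = l /\ r' = r.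

Definition on_line (X : R -> pt) (l r : Rbar) : Prop :=
  exists p v : pt, v <> (0, 0) /\
    forall s, in_ivl l r s -> exists c : R, X s = padd p (pscal c v).

Definition lorentz (L : pt -> pt) : Prop :=
  forall p q, mink (L p) (L q) = mink p q.

Definition congruent (X : R -> pt) (l r : Rbar) (Y : R -> pt) (l' r' : Rbar) : Prop :=
  exists L, lorentz L /\
    (forall s, in_ivl l' r' s -> exists s', in_ivl l r s' /\ Y s = L (X s')) /\
    (forall s', in_ivl l r s' -> exists s, in_ivl l' r' s /\ Y s = L (X s')).

Definition convex_curve (X : R -> pt) (l r : Rbar) : Prop :=
  (forall s, in_ivl l r s -> 0 < curvature X s) \/
  (forall s, in_ivl l r s -> curvature X s < 0).

Definition near_ray (p v q : pt) (eps : R) : Prop :=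
  exists t, 0 <= t /\ enorm (psub q (padd p (pscal t v))) < eps.

Definition right_end_along (X : R -> pt) (l r : Rbar) (p v : pt) : Prop :=
  (forall M, exists s1, in_ivl l r s1 /\
     forall s, in_ivl s1 r s -> M < enorm (X s)) /\
  (forall eps, 0 < eps -> exists s1, in_ivl l r s1 /\
     forall s, in_ivl s1 r s -> near_ray p v (X s) eps).

Definition left_end_along (X : R -> pt) (l r : Rbar) (p v : pt) : Prop :=
  (forall M, exists s1, in_ivl l r s1 /\
     forall s, in_ivl l s1 s -> M < enorm (X s)) /\
  (forall eps, 0 < eps -> exists s1, in_ivl l r s1 /\
     forall s, in_ivl l s1 s -> near_ray p v (X s) eps).

Definition asymptotic_to_cone (X : R -> pt) (l r : Rbar) : Prop :=
  exists p v1 v2 : pt, fst v1 * snd v2 - snd v1 * fst v2 <> 0 /\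
    left_end_along X l r p v1 /\ right_end_along X l r p v2.

Definition symmetric_y_axis (X : R -> pt) (l r : Rbar) : Prop :=
  forall s, in_ivl l r s -> exists s', in_ivl l r s' /\
    X s' = (- fst (X s), snd (X s)).

Definition const_quantity (X : R -> pt) (l r : Rbar) : Prop :=
  exists c, forall s, in_ivl l r s ->
    (curvature X s) ^ 2 * exp (- mink (X s) (X s)) = c.

Definition flow (X : R -> pt) (t s : R) : pt := pscal (sqrt (1 - 2 * t)) (X s).

Definition from_infinity (X : R -> pt) (l r : Rbar) : Prop :=
  forall M, exists T, forall t, t < T ->
    forall s, in_ivl l r s -> M < enorm (flow X t s).

Definition light_cone_halves (p : pt) : Prop :=
  (eta p = 0 /\ 0 < xi p) \/ (xi p = 0 /\ eta p < 0).

(** X_t converges to the set K as t -> 1/2 (local Hausdorff convergence):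
    every point of K is a limit of points of X_t, and on every bounded
    region the points of X_t are uniformly close to K. *)
Definition contracts_to (X : R -> pt) (l r : Rbar) (K : pt -> Prop) : Prop :=
  (forall q, K q -> forall eps, 0 < eps -> exists d, 0 < d /\
     forall t, 1/2 - d < t < 1/2 ->
       exists s, in_ivl l r s /\ enorm (psub (flow X t s) q) < eps) /\
  (forall M eps, 0 < eps -> exists d, 0 < d /\
     forall t, 1/2 - d < t < 1/2 -> forall s, in_ivl l r s ->
       enorm (flow X t s) <= M ->
       exists q, K q /\ enorm (psub (flow X t s) q) < eps).

(* Main.v *)
(** With [tau = <X,T>] one has [X = tau T - k N], and the shrinker equation becomes the
    autonomous system [k' = k tau], [tau' = 1 + k^2], whose first integral is
    [k exp (-<X,X>/2)] with [<X,X> = tau^2 - k^2].  A shrinker that is not straight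
    therefore has [k <> 0] everywhere, and [tau] can serve as parameter: up to sign
    [k = kappa (c + tau^2/2)], where [kappa] inverts [x |-> ln x + x^2/2], and arc length
    and hyperbolic angle are the integrals of [1/(1+k^2)] and [k/(1+k^2)] over [tau].
    This gives one curve for each real [c], and any shrinker equals one of them up to a
    translation of arc length and the linear isometry that matches the tangents.  The total
    length is finite since [k^2] grows quadratically in [tau]; at the right end [eta] stays
    bounded, and [xi eta = tau^2 - k^2] tends to infinity, hence so does [xi]. *)

Require Import Defs.
From Stdlib Require Import Reals Lra Classical FunctionalExtensionality.
From Coquelicot Require Import Coquelicot.
Open Scope R_scope.

(** * Calculus *)

(** In light-like coordinates the metric is the product [xi * eta], a unit tangent is [(p, / p)]
    with [p <> 0], [N] is [(p, - / p)], and [T_s = k N] becomes [p' = k p]; a linear isometry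
    multiplies by [(C, / C)], possibly after exchanging the coordinates. Everything thus reduces to
    scalar functions. Curves are only assumed twice differentiable, so the curvature can be
    differentiated only once it is replaced by [<X,N>], which involves just [X] and [T]. Uniqueness
    comes without ODE theory, from two combinations of [tau], [s] and [p] with zero derivative.
    Maximality is used both ways: the model curves run to infinity in finite length, so they cannot
    be extended, and a maximal shrinker must fill the whole interval of the model that contains it.
    The minimum of [<X,X>], equal to [- kappa c ^ 2], separates the members of the family. The limit
    under the flow needs only crude bounds: for [tau >= 0], [eta] lies between two positive
    constants, and [xi] is bounded below and takes every positive value. *)

Lemma is_derive_pos_increasing (f f' : R -> R) :
  (forall x, is_derive f x (f' x)) -> (forall x, 0 < f' x) ->
  forall x y, x < y -> f x < f y.
Proof.
intros Hd Hp x y Hxy.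
destruct (MVT_gen f x y f') as [c [_ Hc]].
- intros; apply Hd.
- intros z _; apply continuity_pt_filterlim.
  apply @ex_derive_continuous; eexists; apply Hd.
- specialize (Hp c); nra.
Qed.

(** A total inverse: for strictly increasing [f] the set at level [f x] is the half-line up to [x].
    For continuous such [f], a level outside the range has an infinite supremum, which [real] turns
    into 0. *)
Definition rinv (f : R -> R) (y : R) : R := real (Lub_Rbar (fun x => f x <= y)).

Lemma rinv_cancel (f : R -> R) :
  (forall x y, x < y -> f x < f y) -> forall x, rinv f (f x) = x.
Proof.
intros Hf x; unfold rinv.
rewrite (is_lub_Rbar_unique _ (Finite x)); [reflexivity|].
split.
- intros z Hz; simpl; destruct (Rle_lt_dec z x) as [|H]; [assumption|].
  apply Hf in H; lra.
- intros b Hb; apply (Hb x); apply Rle_refl.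
Qed.

Lemma increasing_lt_inv (f : R -> R) :
  (forall x y, x < y -> f x < f y) -> forall x y, f x < f y -> x < y.
Proof.
intros Hf x y H; destruct (Rlt_le_dec x y) as [|[Hlt| ->]]; [assumption| |lra].
apply Hf in Hlt; lra.
Qed.

Lemma derivable_onto (f f' : R -> R) :
  (forall x, is_derive f x (f' x)) ->
  forall x1 x2 y, x1 <= x2 -> f x1 <= y <= f x2 -> exists x, x1 <= x <= x2 /\ f x = y.
Proof.
intros Hd x1 x2 y Hx Hy.
destruct (IVT_gen f x1 x2 y) as [x [Hx1 Hx2]].
- intros x; apply continuity_pt_filterlim.
  apply @ex_derive_continuous; eexists; apply Hd.
- rewrite Rmin_left, Rmax_right; lra.
- rewrite Rmin_left, Rmax_right in Hx1 by lra.
  now exists x.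
Qed.

(** The difference quotient of the inverse is [/ D], where [D] is a difference quotient of [f] at
    [x], and [/ D - / m = - (D - m) / (D * m)]. *)
Lemma is_derive_rinv (f f' : R -> R) :
  (forall x, is_derive f x (f' x)) -> (forall x, 0 < f' x) ->
  forall x, is_derive (rinv f) (f x) (/ f' x).
Proof.
intros Hd Hp x.
pose proof (is_derive_pos_increasing f f' Hd Hp) as Hi.
apply is_derive_Reals; intros e He.
pose proof (Hp x) as Hpx.
assert (Hlim : is_derive f x (f' x)) by apply Hd.
apply is_derive_Reals in Hlim.
set (m := f' x) in *.
(* The first bound gives [D > m / 2], hence [D * m > m * m / 2]; the second then makes the error
   smaller than [e]. *)
assert (He1 : 0 < Rmin (m / 2) (e * m * m / 2)).
{ apply Rmin_glb_lt; [lra|]. apply Rdiv_lt_0_compat; [|lra]. repeat apply Rmult_lt_0_compat; lra. }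
destruct (Hlim _ He1) as [d Hdl].
set (r := d / 2).
assert (Hr : 0 < r) by (unfold r; destruct d as [d Hd0]; simpl; lra).
assert (Hrd : r < d) by (unfold r; destruct d as [d Hd0]; simpl; lra).
assert (H1 : f (x - r) < f x) by (apply Hi; lra).
assert (H2 : f x < f (x + r)) by (apply Hi; lra).
(* Continuity of the inverse: an increment of this size keeps the preimage within [r < d] of [x]. *)
assert (Hdel : 0 < Rmin (f x - f (x - r)) (f (x + r) - f x)) by (apply Rmin_glb_lt; lra).
exists (mkposreal _ Hdel); simpl; intros h Hh0 Hh.
assert (Ha := Rmin_l (f x - f (x - r)) (f (x + r) - f x)).
assert (Hb := Rmin_r (f x - f (x - r)) (f (x + r) - f x)).
apply Rabs_def2 in Hh.
destruct (derivable_onto f f' Hd (x - r) (x + r) (f x + h)) as [z [Hz Hfz]]; [lra|lra|].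
rewrite <- Hfz, !(rinv_cancel f Hi).
set (k := z - x).
assert (Hk0 : k <> 0).
{ unfold k; intros Hk; replace z with x in Hfz by lra; lra. }
assert (Hk : Rabs k < d) by (apply Rabs_def1; unfold k; lra).
specialize (Hdl k Hk0 Hk).
replace (x + k) with z in Hdl by (unfold k; ring).
replace h with (f z - f x) by lra.
set (D := (f z - f x) / k) in *.
assert (HD : f z - f x = D * k) by (unfold D; field; exact Hk0).
assert (HDm : Rabs (D - m) < m / 2) by (eapply Rlt_le_trans; [exact Hdl|apply Rmin_l]).
assert (HDe : Rabs (D - m) < e * m * m / 2) by (eapply Rlt_le_trans; [exact Hdl|apply Rmin_r]).
assert (HDp : m / 2 < D) by (apply Rabs_def2 in HDm; lra).
rewrite HD.
replace (k / (D * k) - / m) with (- (D - m) / (D * m)) by (field; lra).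
unfold Rdiv; rewrite Rabs_mult, Rabs_Ropp, (Rabs_pos_eq (/ (D * m))).
2: { left; apply Rinv_0_lt_compat; nra. }
apply (Rmult_lt_reg_r (D * m)); [nra|].
rewrite Rmult_assoc, Rinv_l, Rmult_1_r by nra.
eapply Rlt_trans; [exact HDe|].
assert (0 < e * m) by nra. nra.
Qed.

Lemma is_derive_primitive (f : R -> R) (t : R) :
  (forall x, continuous f x) -> is_derive (fun t => RInt f 0 t) t (f t).
Proof.
intros Hc; apply (is_derive_RInt f _ 0 t); [|apply Hc].
apply filter_forall; intros b.
apply (RInt_correct (V := R_CompleteNormedModule)), ex_RInt_continuous; intros; apply Hc.
Qed.

(** The change splits into the integral of [f a] from [t0] to [t], at most [|t - t0|], and the
    integral of [f a - f a0] over the fixed interval from 0 to [t0], small by uniform closeness. *)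
Lemma continuous_primitive_param (f : R -> R -> R) (a0 t0 : R) :
  (forall a x, continuous (f a) x) -> (forall a x, Rabs (f a x) <= 1) ->
  (forall eps, 0 < eps -> locally a0 (fun a => forall x, Rabs (f a x - f a0 x) <= eps)) ->
  continuous (fun z : R * R => RInt (f (fst z)) 0 (snd z)) (a0, t0).
Proof.
intros Hc Hb Hu.
assert (Hex : forall a x y, ex_RInt (f a) x y)
  by (intros a x y; apply (ex_RInt_continuous (V := R_CompleteNormedModule)); intros; apply Hc).
apply filterlim_locally; intros [e He].
(* Chosen so that [|t0| * (e / N) < e / 2]; the added 1 covers [t0 = 0]. *)
set (N := 2 * (1 + Rabs t0)).
assert (HN : 0 < N) by (unfold N; pose proof (Rabs_pos t0); lra).
assert (HeN : 0 < e / N) by (apply Rdiv_lt_0_compat; lra).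
destruct (Hu _ HeN) as [d1 Hd1].
assert (Hd : 0 < Rmin d1 (e / 2)) by (apply Rmin_glb_lt; [apply cond_pos|lra]).
exists (mkposreal _ Hd); intros [a t] [Ha Ht]; simpl in *.
change (Rabs (t - t0) < Rmin d1 (e / 2)) in Ht.
change (Rabs (a - a0) < Rmin d1 (e / 2)) in Ha.
change (Rabs (RInt (f a) 0 t - RInt (f a0) 0 t0) < e).
pose proof (Rmin_l d1 (e / 2)); pose proof (Rmin_r d1 (e / 2)).
assert (Ha' : forall x, Rabs (f a x - f a0 x) <= e / N).
{ apply Hd1. change (Rabs (a - a0) < d1). lra. }
rewrite <- (RInt_Chasles (f a) 0 t0 t) by apply Hex.
change plus with Rplus.
replace (RInt (f a) 0 t0 + RInt (f a) t0 t - RInt (f a0) 0 t0)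
  with (RInt (f a) t0 t + (RInt (f a) 0 t0 - RInt (f a0) 0 t0)) by ring.
assert (Gen : forall (g : R -> R) x y M, ex_RInt g x y -> (forall z, Rabs (g z) <= M) ->
   Rabs (RInt g x y) <= Rabs (y - x) * M).
{ intros g x y M Hg HM.
  destruct (Rle_lt_dec x y) as [Hxy|Hxy].
  - rewrite (Rabs_pos_eq (y - x)) by lra. apply abs_RInt_le_const; auto.
  - rewrite <- opp_RInt_swap by now apply ex_RInt_swap. change opp with Ropp.
    rewrite Rabs_Ropp, Rabs_minus_sym.
    rewrite (Rabs_pos_eq (x - y)) by lra. apply abs_RInt_le_const; auto; [lra|].
    now apply ex_RInt_swap. }
eapply Rle_lt_trans; [apply Rabs_triang|].
assert (B1 := Gen (f a) t0 t 1 (Hex _ _ _) (Hb a)).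
assert (B2 : Rabs (RInt (f a) 0 t0 - RInt (f a0) 0 t0) <= Rabs (t0 - 0) * (e / N)).
{ replace (RInt (f a) 0 t0 - RInt (f a0) 0 t0) with (RInt (fun x => minus (f a x) (f a0 x)) 0 t0).
  - apply Gen; [|exact Ha']. now apply @ex_RInt_minus.
  - now apply @RInt_minus. }
rewrite Rminus_0_r in B2.
assert (B3 : Rabs t0 * (e / N) < e / 2).
{ unfold N. apply (Rmult_lt_reg_r (2 * (1 + Rabs t0))); [exact HN|].
  field_simplify; [|unfold N in HN; lra]. pose proof (Rabs_pos t0). nra. }
lra.
Qed.

(** This takes the place of ODE uniqueness: the first integral and the constants that match a
    shrinker with a model curve are all obtained here. *)
Lemma constant_on_ivl (f : R -> R) (l r : Rbar) :
  (forall s, in_ivl l r s -> is_derive f s 0) ->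
  forall s1 s2, in_ivl l r s1 -> in_ivl l r s2 -> f s1 = f s2.
Proof.
assert (W : (forall s, in_ivl l r s -> is_derive f s 0) ->
  forall s1 s2, s1 < s2 -> in_ivl l r s1 -> in_ivl l r s2 -> f s1 = f s2).
{ intros Hd s1 s2 Hs H1 H2; apply (eq_is_derive f s1 s2); [|exact Hs].
  intros t Ht; apply Hd; split.
  - apply (Rbar_lt_le_trans _ s1); [apply H1|simpl; lra].
  - apply (Rbar_le_lt_trans _ s2); [simpl; lra|apply H2]. }
intros Hd s1 s2 H1 H2; destruct (Rtotal_order s1 s2) as [H|[->|H]]; auto.
symmetry; auto.
Qed.

Lemma locally_in_ivl (l r : Rbar) (s : R) :
  in_ivl l r s -> locally s (in_ivl l r).
Proof.
intros [H1 H2]; apply filter_and; [exact (open_Rbar_gt' s l H1)|exact (open_Rbar_lt' s r H2)].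
Qed.

Lemma in_ivl_nonempty (l r : Rbar) : Rbar_lt l r -> exists s, in_ivl l r s.
Proof.
intros Hlr; destruct l as [l| |], r as [r| |]; simpl in Hlr; try tauto.
- exists ((l + r) / 2); split; simpl; lra.
- exists (l + 1); split; simpl; auto; lra.
- exists (r - 1); split; simpl; auto; lra.
- exists 0; split; simpl; auto.
Qed.

Lemma in_ivl_bounds (l r : Rbar) (m M : R) :
  Rbar_lt l r -> (forall s, in_ivl l r s -> m < s < M) -> Rbar_le m l /\ Rbar_le r M.
Proof.
intros Hlr H.
destruct (in_ivl_nonempty l r Hlr) as [s0 [H1 H2]].
split.
- destruct (Rbar_le_lt_dec m l) as [|Hl]; [assumption|exfalso].
  assert (Hs : in_ivl l r (Rmin s0 m)).
  { split.
    - unfold Rmin; destruct Rle_dec; assumption.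
    - apply (Rbar_le_lt_trans _ s0); [apply Rmin_l|assumption]. }
  apply H in Hs. pose proof (Rmin_r s0 m). lra.
- destruct (Rbar_le_lt_dec r M) as [|Hl]; [assumption|exfalso].
  assert (Hs : in_ivl l r (Rmax s0 M)).
  { split.
    - apply (Rbar_lt_le_trans _ s0); [assumption|apply Rmax_l].
    - unfold Rmax; destruct Rle_dec; assumption. }
  apply H in Hs. pose proof (Rmax_r s0 M). lra.
Qed.

(** * The profile [k] as a function of [tau = <X,T>] *)

(** The logarithm of [kappa]. Passing to [x = ln k] turns [ln k + k^2/2] into a function increasing
    from all of R onto R, so no positivity condition enters the inversion. *)
Definition ell : R -> R := rinv (fun x => x + exp (2 * x) / 2).
Definition kappa (w : R) : R := exp (ell w).

Lemma is_derive_ell_inv (x : R) :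
  is_derive (fun x => x + exp (2 * x) / 2) x (1 + exp (2 * x)).
Proof. auto_derive; [trivial|field]. Qed.

Lemma ell_inv_increasing (x y : R) :
  x < y -> x + exp (2 * x) / 2 < y + exp (2 * y) / 2.
Proof.
apply (is_derive_pos_increasing (fun x => x + exp (2 * x) / 2) (fun x => 1 + exp (2 * x))).
- exact is_derive_ell_inv.
- intros z; pose proof (exp_pos (2 * z)); lra.
Qed.

Lemma ell_cancel (x : R) : ell (x + exp (2 * x) / 2) = x.
Proof. exact (rinv_cancel (fun x => x + exp (2 * x) / 2) ell_inv_increasing x). Qed.

Lemma kappa_sqr (w : R) : kappa w ^ 2 = exp (2 * ell w).
Proof. unfold kappa; replace (2 * ell w) with (ell w + ell w) by ring; rewrite exp_plus; ring. Qed.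

Lemma ell_eq (w : R) : ell w + kappa w ^ 2 / 2 = w.
Proof.
rewrite kappa_sqr.
(* At [w] the function exceeds [w]; at [w - exp (2 * w) / 2] its exponential term is smaller than at
   [w], so the value falls below [w]. *)
destruct (derivable_onto _ _ is_derive_ell_inv (w - exp (2 * w) / 2) w w) as [x [_ Hx]].
- pose proof (exp_pos (2 * w)); lra.
- split; [|pose proof (exp_pos (2 * w)); lra].
  assert (exp (2 * (w - exp (2 * w) / 2)) < exp (2 * w)); [|lra].
  apply exp_increasing; pose proof (exp_pos (2 * w)); lra.
- rewrite <- Hx, ell_cancel; reflexivity.
Qed.

Lemma kappa_pos (w : R) : 0 < kappa w.
Proof. apply exp_pos. Qed.

Lemma is_derive_ell (w : R) : is_derive ell w (/ (1 + kappa w ^ 2)).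
Proof.
rewrite kappa_sqr.
pose proof (is_derive_rinv _ _ is_derive_ell_inv) as H.
assert (Hp : forall x, 0 < 1 + exp (2 * x)) by (intros x; pose proof (exp_pos (2 * x)); lra).
specialize (H Hp (ell w)); simpl in H.
rewrite <- kappa_sqr, ell_eq, kappa_sqr in H; exact H.
Qed.

Lemma is_derive_kappa (w : R) : is_derive kappa w (kappa w / (1 + kappa w ^ 2)).
Proof.
unfold kappa at 1.
evar_last.
- apply (is_derive_comp exp ell w); [apply is_derive_exp|apply is_derive_ell].
- unfold scal; simpl; unfold mult; simpl; unfold Rdiv, kappa; ring.
Qed.

Lemma ell_increasing (x y : R) : x < y -> ell x < ell y.
Proof.
apply (is_derive_pos_increasing _ _ is_derive_ell).
intros z; apply Rinv_0_lt_compat; pose proof (kappa_pos z); nra.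
Qed.

Lemma kappa_increasing (x y : R) : x < y -> kappa x < kappa y.
Proof. intros H; apply exp_increasing, ell_increasing, H. Qed.

Lemma kappa_le (x y : R) : x <= y -> kappa x <= kappa y.
Proof. intros [H| ->]; [left; now apply kappa_increasing|lra]. Qed.

Lemma kappa_lipschitz (x y : R) : Rabs (kappa x - kappa y) <= Rabs (x - y).
Proof.
destruct (MVT_gen kappa y x (fun w => kappa w / (1 + kappa w ^ 2))) as [z [_ Hz]].
- intros; apply is_derive_kappa.
- intros w _; apply continuity_pt_filterlim.
  apply @ex_derive_continuous; eexists; apply is_derive_kappa.
- rewrite Hz, Rabs_mult.
  pose proof (kappa_pos z) as Hk.
  assert (Rabs (kappa z / (1 + kappa z ^ 2)) <= 1).
  { rewrite Rabs_pos_eq.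
    - apply (Rmult_le_reg_r (1 + kappa z ^ 2)); [nra|]. field_simplify; nra.
    - apply Rmult_le_pos; [lra|]. left; apply Rinv_0_lt_compat; nra. }
  pose proof (Rabs_pos (x - y)); nra.
Qed.

(** From [1 + 2 x <= exp (2 x)] at [x = ell w]. This is the growth that makes the total length
    finite. *)
Lemma kappa_sqr_ge (w : R) : w <= kappa w ^ 2.
Proof.
rewrite <- (ell_eq w) at 1.
assert (H : 1 + 2 * ell w <= exp (2 * ell w)) by apply exp_ineq1_le.
rewrite <- kappa_sqr in H; lra.
Qed.

Lemma kappa_eq_exp (k w : R) : 0 < k -> k * exp (k ^ 2 / 2) = exp w -> kappa w = k.
Proof.
intros Hk H.
assert (Hw : w = ln k + exp (2 * ln k) / 2).
{ replace (exp (2 * ln k)) with (k ^ 2).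
  - apply exp_inv; rewrite exp_plus, exp_ln; auto.
  - replace (2 * ln k) with (ln k + ln k) by ring; rewrite exp_plus, exp_ln by assumption; ring. }
unfold kappa; rewrite Hw, ell_cancel; now apply exp_ln.
Qed.

Definition curv (c u : R) : R := kappa (c + u ^ 2 / 2).

Lemma curv_pos (c u : R) : 0 < curv c u.
Proof. apply kappa_pos. Qed.

Lemma one_plus_sqr_pos (x : R) : 0 < 1 + x ^ 2.
Proof. nra. Qed.

Lemma is_derive_curv (c u : R) :
  is_derive (curv c) u (curv c u * u / (1 + curv c u ^ 2)).
Proof.
unfold curv at 1.
evar_last.
- apply (is_derive_comp kappa (fun u => c + u ^ 2 / 2) u (kappa (c + u ^ 2 / 2) / (1 + kappa (c + u ^ 2 / 2) ^ 2)) u).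
  + apply is_derive_kappa.
  + auto_derive; [trivial|field].
- change (u * (curv c u / (1 + curv c u ^ 2)) = curv c u * u / (1 + curv c u ^ 2)).
  unfold Rdiv; ring.
Qed.

Lemma continuous_curv (c u : R) : continuous (curv c) u.
Proof. apply @ex_derive_continuous; eexists; apply is_derive_curv. Qed.

Lemma curv_opp (c u : R) : curv c (- u) = curv c u.
Proof. unfold curv; f_equal; simpl; field. Qed.

Lemma curv_0 (c : R) : curv c 0 = kappa c.
Proof. unfold curv; f_equal; simpl; field. Qed.

(* [<X,X> = tau^2 - k^2] along the curve. *)
Lemma curv_quadratic (c u : R) : u ^ 2 - curv c u ^ 2 = 2 * ell (c + u ^ 2 / 2) - 2 * c.
Proof. unfold curv; pose proof (ell_eq (c + u ^ 2 / 2)); lra. Qed.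

(** * Arc length and hyperbolic angle as functions of [tau] *)

Definition arc_rate (c u : R) : R := / (1 + curv c u ^ 2).
Definition ang_rate (c u : R) : R := curv c u / (1 + curv c u ^ 2).

Definition arc (c u : R) : R := RInt (arc_rate c) 0 u.
Definition ang (c u : R) : R := RInt (ang_rate c) 0 u.

Lemma continuous_arc_rate (c u : R) : continuous (arc_rate c) u.
Proof.
apply @ex_derive_continuous.
apply (ex_derive_inv (fun u => 1 + curv c u ^ 2) u).
- auto_derive; eexists; apply is_derive_curv.
- pose proof (one_plus_sqr_pos (curv c u)) as H; lra.
Qed.

Lemma continuous_ang_rate (c u : R) : continuous (ang_rate c) u.
Proof.
apply (continuous_mult (curv c) (arc_rate c)); [apply continuous_curv|apply continuous_arc_rate].
Qed.

Lemma is_derive_arc (c u : R) : is_derive (arc c) u (/ (1 + curv c u ^ 2)).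
Proof. exact (is_derive_primitive (arc_rate c) u (continuous_arc_rate c)). Qed.

Lemma is_derive_ang (c u : R) : is_derive (ang c) u (curv c u / (1 + curv c u ^ 2)).
Proof. exact (is_derive_primitive (ang_rate c) u (continuous_ang_rate c)). Qed.

Lemma arc_0 (c : R) : arc c 0 = 0.
Proof. exact (RInt_point 0 _). Qed.

Lemma ang_0 (c : R) : ang c 0 = 0.
Proof. exact (RInt_point 0 _). Qed.

Lemma arc_increasing (c x y : R) : x < y -> arc c x < arc c y.
Proof.
apply (is_derive_pos_increasing _ _ (is_derive_arc c)).
intros z; apply Rinv_0_lt_compat, one_plus_sqr_pos.
Qed.

Lemma odd_of_even_derivative (f f' : R -> R) :
  (forall x, is_derive f x (f' x)) -> (forall x, f' (- x) = f' x) -> f 0 = 0 ->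
  forall x, f (- x) = - f x.
Proof.
intros Hd He H0 x.
assert (H : f x + f (- x) = f 0 + f (- 0)).
{ apply (constant_on_ivl (fun x => f x + f (- x)) m_infty p_infty); [|split; exact I..].
  intros s _.
  evar_last.
  - apply (is_derive_plus f (fun x => f (- x))); [apply Hd|].
    apply (is_derive_comp f Ropp); [apply Hd|]. auto_derive; [trivial|reflexivity].
  - rewrite He; unfold plus, scal; simpl; unfold mult; simpl; ring. }
rewrite Ropp_0, H0 in H; lra.
Qed.

Lemma arc_opp (c u : R) : arc c (- u) = - arc c u.
Proof.
apply (odd_of_even_derivative _ _ (is_derive_arc c)); [|apply arc_0].
intros; now rewrite curv_opp.
Qed.

Lemma ang_opp (c u : R) : ang c (- u) = - ang c u.
Proof.
apply (odd_of_even_derivative _ _ (is_derive_ang c)); [|apply ang_0].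
intros; now rewrite curv_opp.
Qed.

Lemma curv_quadratic_growth (c : R) :
  exists m, 0 < m /\ forall u, m * (1 + u ^ 2) <= 1 + curv c u ^ 2.
Proof.
(* With this [t], [t * |c| <= 1/2] and [t <= 1], so [1 + k^2 >= 1 + t * (c + u^2/2) >= 1/2 + t *
   u^2/2], which dominates [t / 2 * (1 + u^2)]. *)
set (t := / (2 * (1 + Rabs c))).
pose proof (Rabs_pos c) as Hc.
assert (Ht : 0 < t) by (apply Rinv_0_lt_compat; lra).
assert (Ht1 : t * (2 * (1 + Rabs c)) = 1) by (apply Rinv_l; lra).
exists (t / 2); split; [lra|]; intros u.
assert (H1 := kappa_sqr_ge (c + u ^ 2 / 2)); fold (curv c u) in H1.
assert (H2 : - Rabs c <= c) by (unfold Rabs; destruct Rcase_abs; lra).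
assert (H3 : 0 <= curv c u ^ 2) by apply pow2_ge_0.
assert (H4 : t <= 1) by nra.
assert (H5 : t * (c + u ^ 2 / 2) <= curv c u ^ 2) by nra.
nra.
Qed.

(** Comparison with [atan u / m]: its derivative dominates that of [arc c], and both vanish at 0. *)
Lemma arc_bounded (c : R) : exists B, forall u, arc c u <= B.
Proof.
destruct (curv_quadratic_growth c) as [m [Hm H]].
exists (PI / 2 / m); intros u.
assert (Hd : forall u, is_derive (fun u => atan u / m - arc c u) u
   (/ (1 + u ^ 2) / m - / (1 + curv c u ^ 2))).
{ intros v; apply (is_derive_minus (fun u => atan u / m) (arc c)); [|apply is_derive_arc].
  apply (is_derive_scal_l atan v (/ (1 + v ^ 2)) (/ m)), is_derive_Reals, derivable_pt_lim_atan. }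
assert (Hp : forall v, 0 <= / (1 + v ^ 2) / m - / (1 + curv c v ^ 2)).
{ intros v; unfold Rdiv; rewrite <- Rinv_mult.
  specialize (H v). pose proof (one_plus_sqr_pos v).
  assert (/ (1 + curv c v ^ 2) <= / ((1 + v ^ 2) * m)); [|lra].
  apply Rinv_le_contravar; nra. }
destruct (Rle_lt_dec u 0) as [Hu|Hu].
- assert (arc c u <= 0).
  { destruct Hu as [Hu| ->]; [|rewrite arc_0; lra].
    apply (arc_increasing c) in Hu; rewrite arc_0 in Hu; lra. }
  assert (0 < PI / 2 / m) by (apply Rdiv_lt_0_compat; [pose proof PI_RGT_0; lra|lra]); lra.
- destruct (MVT_gen (fun u => atan u / m - arc c u) 0 u _ (fun v _ => Hd v)) as [z [_ Hz]].
  + intros v _; apply continuity_pt_filterlim.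
    apply (ex_derive_continuous (fun u => atan u / m - arc c u) v); eexists; exact (Hd v).
  + rewrite arc_0, atan_0 in Hz; specialize (Hp z).
    assert (0 <= atan u / m - arc c u) by nra.
    assert (atan u / m <= PI / 2 / m); [|lra].
    apply Rmult_le_compat_r; [left; now apply Rinv_0_lt_compat|].
    pose proof (atan_bound u); lra.
Qed.

(** Half the total length. The supremum is finite by [arc_bounded], so [real] loses nothing, and it
    is not attained; the curve therefore lives on an open symmetric interval. *)
Definition smax (c : R) : R := real (Lub_Rbar (fun y => exists u, y = arc c u)).

Lemma smax_lub (c : R) : is_lub_Rbar (fun y => exists u, y = arc c u) (smax c).
Proof.
pose proof (Lub_Rbar_correct (fun y => exists u, y = arc c u)) as H.
unfold smax; destruct (Lub_Rbar _) as [x| |]; [exact H|exfalso|exfalso].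
- destruct (arc_bounded c) as [B HB].
  apply (proj2 H B); intros y [u ->]; apply HB.
- apply (proj1 H (arc c 0)); now exists 0.
Qed.

Lemma arc_lt_smax (c u : R) : arc c u < smax c.
Proof.
apply (Rlt_le_trans _ (arc c (u + 1))); [apply arc_increasing; lra|].
apply (proj1 (smax_lub c)); now exists (u + 1).
Qed.

Lemma arc_gt_opp_smax (c u : R) : - smax c < arc c u.
Proof. pose proof (arc_lt_smax c (- u)) as H; rewrite arc_opp in H; lra. Qed.

Lemma arc_approaches_smax (c s : R) : s < smax c -> exists u, s < arc c u.
Proof.
intros H; apply NNPP; intros Hn.
assert (smax c <= s); [|lra].
apply (proj2 (smax_lub c) s); intros y [u ->]; simpl.
destruct (Rle_lt_dec (arc c u) s); [assumption|exfalso; apply Hn; now exists u].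
Qed.

Lemma arc_onto (c s : R) : - smax c < s < smax c -> exists u, arc c u = s.
Proof.
intros [H1 H2].
destruct (arc_approaches_smax c s H2) as [u2 Hu2].
destruct (arc_approaches_smax c (- s)) as [u1 Hu1]; [lra|].
rewrite <- (Ropp_involutive u1), arc_opp in Hu1.
destruct (derivable_onto _ _ (is_derive_arc c) (- u1) u2 s) as [u [_ Hu]].
- left; apply (increasing_lt_inv (arc c) (arc_increasing c)); lra.
- lra.
- now exists u.
Qed.

Definition tau (c : R) : R -> R := rinv (arc c).

Lemma tau_arc (c u : R) : tau c (arc c u) = u.
Proof. exact (rinv_cancel (arc c) (arc_increasing c) u). Qed.

Lemma tau_0 (c : R) : tau c 0 = 0.
Proof. pose proof (tau_arc c 0) as H; now rewrite arc_0 in H. Qed.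

Lemma arc_tau (c s : R) : - smax c < s < smax c -> arc c (tau c s) = s.
Proof. intros H; destruct (arc_onto c s H) as [u <-]; now rewrite tau_arc. Qed.

Lemma is_derive_tau (c s : R) :
  - smax c < s < smax c -> is_derive (tau c) s (1 + curv c (tau c s) ^ 2).
Proof.
intros H; rewrite <- (arc_tau c s H) at 1.
evar_last.
- apply (is_derive_rinv _ _ (is_derive_arc c)).
  intros x; apply Rinv_0_lt_compat, one_plus_sqr_pos.
- apply Rinv_inv.
Qed.

Lemma tau_opp (c s : R) : - smax c < s < smax c -> tau c (- s) = - tau c s.
Proof.
intros H; destruct (arc_onto c s H) as [u <-].
now rewrite <- arc_opp, !tau_arc.
Qed.

(** * Light-like coordinates *)

(** The point with light-like coordinates [xi = u] and [eta = v]. *)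
Definition lc (u v : R) : pt := ((u + v) / 2, (u - v) / 2).

Lemma xi_lc (u v : R) : xi (lc u v) = u.
Proof. unfold xi, lc; simpl; field. Qed.

Lemma eta_lc (u v : R) : eta (lc u v) = v.
Proof. unfold eta, lc; simpl; field. Qed.

Lemma lc_xi_eta (q : pt) : lc (xi q) (eta q) = q.
Proof. destruct q; unfold xi, eta, lc; simpl; f_equal; field. Qed.

Lemma mink_lc (p q : pt) : mink p q = (xi p * eta q + eta p * xi q) / 2.
Proof. unfold mink, xi, eta; field. Qed.

Lemma enorm_lc_le (u v : R) : enorm (lc u v) <= Rabs u + Rabs v.
Proof.
pose proof (Rabs_pos u); pose proof (Rabs_pos v).
unfold enorm; rewrite <- (sqrt_pow2 (Rabs u + Rabs v)) by lra.
apply sqrt_le_1_alt; simpl fst; simpl snd.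
pose proof (pow2_abs u); pose proof (pow2_abs v); nra.
Qed.

Lemma abs_eta_le_enorm (q : pt) : Rabs (eta q) <= 2 * enorm q.
Proof.
unfold enorm, eta; pose proof (sqrt_plus_sqr (fst q) (snd q)) as [H _].
pose proof (Rmax_l (Rabs (fst q)) (Rabs (snd q))).
pose proof (Rmax_r (Rabs (fst q)) (Rabs (snd q))).
unfold Rminus; eapply Rle_trans; [apply Rabs_triang|rewrite Rabs_Ropp; lra].
Qed.

Lemma abs_xi_le_enorm (q : pt) : Rabs (xi q) <= 2 * enorm q.
Proof.
unfold enorm, xi; pose proof (sqrt_plus_sqr (fst q) (snd q)) as [H _].
pose proof (Rmax_l (Rabs (fst q)) (Rabs (snd q))).
pose proof (Rmax_r (Rabs (fst q)) (Rabs (snd q))).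
eapply Rle_trans; [apply Rabs_triang|lra].
Qed.

(** * The shrinker equations in light-like coordinates *)

Section LightConeCriterion.

Variables (l r : Rbar) (u v p k : R -> R).
Hypothesis ltlr : Rbar_lt l r.
Hypothesis du : forall s, in_ivl l r s -> is_derive u s (p s).
Hypothesis dv : forall s, in_ivl l r s -> is_derive v s (/ p s).
Hypothesis p0 : forall s, in_ivl l r s -> p s <> 0.
Hypothesis dp : forall s, in_ivl l r s -> is_derive p s (k s * p s).
Hypothesis suppk : forall s, in_ivl l r s -> v s * p s - u s * / p s = 2 * k s.

Let X (s : R) : pt := lc (u s) (v s).

Let is_derive_fst (s : R) : in_ivl l r s -> is_derive (fun t => fst (X t)) s ((p s + / p s) / 2).
Proof.
intros Hs; apply (is_derive_scal_l (fun t => u t + v t) s (p s + / p s) (/ 2)).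
apply (is_derive_plus u v); auto.
Qed.

Let is_derive_snd (s : R) : in_ivl l r s -> is_derive (fun t => snd (X t)) s ((p s - / p s) / 2).
Proof.
intros Hs; apply (is_derive_scal_l (fun t => u t - v t) s (p s - / p s) (/ 2)).
apply (is_derive_minus u v); auto.
Qed.

Let tangent_lc (s : R) : in_ivl l r s -> tangent X s = lc (p s) (/ p s).
Proof.
intros Hs; unfold tangent, dcurve, lc; f_equal; apply is_derive_unique; auto.
Qed.

Let is_derive_inv_p (s : R) : in_ivl l r s -> is_derive (fun t => / p t) s (- (k s * / p s)).
Proof.
intros Hs; evar_last; [apply is_derive_inv; [apply dp, Hs|apply p0, Hs]|].
field; apply p0, Hs.
Qed.

Let is_derive_fst_tangent (s : R) : in_ivl l r s ->
  is_derive (fun t => fst (tangent X t)) s ((k s * p s - k s * / p s) / 2).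
Proof.
(* The formula for [tangent X] holds only inside the interval, so openness is used to differentiate
   it. *)
intros Hs; apply (is_derive_ext_loc (fun t => (p t + / p t) / 2)).
- apply (filter_imp (in_ivl l r)); [|now apply locally_in_ivl].
  intros t Ht; now rewrite tangent_lc.
- apply (is_derive_scal_l (fun t => p t + / p t) s (k s * p s + - (k s * / p s)) (/ 2)).
  apply (is_derive_plus p (fun t => / p t)); auto.
Qed.

Let is_derive_snd_tangent (s : R) : in_ivl l r s ->
  is_derive (fun t => snd (tangent X t)) s ((k s * p s + k s * / p s) / 2).
Proof.
intros Hs; apply (is_derive_ext_loc (fun t => (p t - / p t) / 2)).
- apply (filter_imp (in_ivl l r)); [|now apply locally_in_ivl].
  intros t Ht; now rewrite tangent_lc.
- replace (k s * p s + k s * / p s) with (k s * p s - - (k s * / p s)) by ring.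
  apply (is_derive_scal_l (fun t => p t - / p t) s (k s * p s - - (k s * / p s)) (/ 2)).
  apply (is_derive_minus p (fun t => / p t)); auto.
Qed.

Lemma curvature_lc (s : R) : in_ivl l r s -> curvature X s = k s.
Proof.
intros Hs; unfold curvature, normal; rewrite tangent_lc by assumption.
replace (dcurve (tangent X) s)
  with ((k s * p s - k s * / p s) / 2, (k s * p s + k s * / p s) / 2)
  by (symmetry; unfold dcurve; f_equal; apply is_derive_unique; auto).
unfold mink, hmul, lc; simpl; field; auto.
Qed.

(** The tangent is [(p, / p)], of square 1; [dp] is [T_s = k N]; and [<X,N> = (v p - u / p) / 2], so
    [suppk] is the shrinker equation. Either sign of [p] is allowed, which covers tangents pointing
    to the left. *)
Lemma shrinker_lc : shrinker X l r.
Proof.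
repeat split; auto.
- eexists; apply is_derive_fst; assumption.
- eexists; apply is_derive_snd; assumption.
- eexists; apply is_derive_fst_tangent; assumption.
- eexists; apply is_derive_snd_tangent; assumption.
- intros s Hs; rewrite tangent_lc by assumption.
  unfold mink, lc; simpl; field; auto.
- intros s Hs; rewrite curvature_lc by assumption.
  unfold normal; rewrite tangent_lc by assumption.
  rewrite <- (Rmult_1_l (k s)), <- (Rinv_l 2), Rmult_assoc, <- suppk by (auto; lra).
  unfold X, mink, hmul, lc; simpl; field; auto.
Qed.

End LightConeCriterion.

(** * The family *)

(* Light-like coordinates of [X = tau T - k N] when [T] has [xi]-coordinate [exp (ang c tau)]. *)
Definition xi_profile (c u : R) : R := (u - curv c u) * exp (ang c u).
Definition eta_profile (c u : R) : R := (u + curv c u) * exp (- ang c u).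

(** Normalised by [tau = 0] and angle 0 at [s = 0]: the vertex is [(0, - kappa c)] with horizontal
    tangent, so reflection in the y-axis is [s -> - s]. *)
Definition curve (c s : R) : pt := lc (xi_profile c (tau c s)) (eta_profile c (tau c s)).

(** This is [X_s = T] times [ds/dtau = 1/(1+k^2)]; the terms containing [u] from the derivatives of
    [curv] and [ang] cancel. *)
Lemma is_derive_xi_profile (c u : R) :
  is_derive (xi_profile c) u (exp (ang c u) / (1 + curv c u ^ 2)).
Proof.
evar_last.
- apply (is_derive_mult (fun u => u - curv c u) (fun u => exp (ang c u))); [| |apply Rmult_comm].
  + apply (is_derive_minus (fun u => u) (curv c)); [apply is_derive_id|apply is_derive_curv].
  + apply (is_derive_comp exp (ang c)); [apply is_derive_exp|apply is_derive_ang].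
- unfold minus, plus, opp, mult, scal, one; simpl; unfold mult; simpl.
  pose proof (one_plus_sqr_pos (curv c u)) as H; simpl in H; field; lra.
Qed.

Lemma is_derive_eta_profile (c u : R) :
  is_derive (eta_profile c) u (exp (- ang c u) / (1 + curv c u ^ 2)).
Proof.
evar_last.
- apply (is_derive_mult (fun u => u + curv c u) (fun u => exp (- ang c u))); [| |apply Rmult_comm].
  + apply (is_derive_plus (fun u => u) (curv c)); [apply is_derive_id|apply is_derive_curv].
  + apply (is_derive_comp exp (fun u => - ang c u)); [apply is_derive_exp|].
    apply (is_derive_opp (ang c)), is_derive_ang.
- unfold plus, opp, mult, scal, one; simpl; unfold mult; simpl.
  pose proof (one_plus_sqr_pos (curv c u)) as H; simpl in H; field; lra.
Qed.

Lemma xi_profile_opp (c u : R) : xi_profile c (- u) = - eta_profile c u.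
Proof. unfold xi_profile, eta_profile; rewrite curv_opp, ang_opp; ring. Qed.

Lemma eta_profile_opp (c u : R) : eta_profile c (- u) = - xi_profile c u.
Proof. unfold xi_profile, eta_profile; rewrite curv_opp, ang_opp, Ropp_involutive; ring. Qed.

Lemma xi_profile_0 (c : R) : xi_profile c 0 = - kappa c.
Proof. unfold xi_profile; rewrite curv_0, ang_0, exp_0; ring. Qed.

Lemma eta_profile_0 (c : R) : eta_profile c 0 = kappa c.
Proof. unfold eta_profile; rewrite curv_0, ang_0, Ropp_0, exp_0; ring. Qed.

Lemma xi_profile_increasing (c x y : R) : x < y -> xi_profile c x < xi_profile c y.
Proof.
apply (is_derive_pos_increasing _ _ (is_derive_xi_profile c)).
intros z; apply Rdiv_lt_0_compat; [apply exp_pos|apply one_plus_sqr_pos].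
Qed.

Lemma eta_profile_increasing (c x y : R) : x < y -> eta_profile c x < eta_profile c y.
Proof.
apply (is_derive_pos_increasing _ _ (is_derive_eta_profile c)).
intros z; apply Rdiv_lt_0_compat; [apply exp_pos|apply one_plus_sqr_pos].
Qed.

Lemma xi_profile_ge (c u : R) : 0 <= u -> - kappa c <= xi_profile c u.
Proof.
rewrite <- xi_profile_0; intros [H| <-]; [left; now apply xi_profile_increasing|lra].
Qed.

Lemma eta_profile_ge (c u : R) : 0 <= u -> kappa c <= eta_profile c u.
Proof.
rewrite <- eta_profile_0; intros [H| <-]; [left; now apply eta_profile_increasing|lra].
Qed.

Lemma ang_nonneg (c u : R) : 0 <= u -> 0 <= ang c u.
Proof.
intros [H| <-]; [|rewrite ang_0; lra].
rewrite <- (ang_0 c); left; revert H.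
apply (is_derive_pos_increasing _ _ (is_derive_ang c)).
intros z; apply Rdiv_lt_0_compat; [apply curv_pos|apply one_plus_sqr_pos].
Qed.

Lemma profile_product (c u : R) :
  xi_profile c u * eta_profile c u = 2 * ell (c + u ^ 2 / 2) - 2 * c.
Proof.
rewrite <- curv_quadratic; unfold xi_profile, eta_profile.
rewrite exp_Ropp; field; apply Rgt_not_eq, exp_pos.
Qed.

(* The derivative of [eta_profile] is at most that of arc length where [ang >= 0]. *)
Lemma eta_profile_le (c u : R) : eta_profile c u <= kappa c + smax c.
Proof.
assert (Hpos : forall u, 0 < u -> eta_profile c u <= kappa c + smax c).
{ clear u; intros u Hu.
  assert (Hd : forall x, is_derive (fun x => eta_profile c x - arc c x) x
     (exp (- ang c x) / (1 + curv c x ^ 2) - / (1 + curv c x ^ 2))).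
  { intros x; apply (is_derive_minus (eta_profile c) (arc c));
      [apply is_derive_eta_profile|apply is_derive_arc]. }
  destruct (MVT_gen (fun x => eta_profile c x - arc c x) 0 u _ (fun x _ => Hd x))
    as [z [Hz Hmvt]].
  - intros x _; apply continuity_pt_filterlim.
    apply (ex_derive_continuous (fun x => eta_profile c x - arc c x) x); eexists; exact (Hd x).
  - rewrite Rmin_left in Hz by lra.
    assert (He : exp (- ang c z) <= 1).
    { rewrite <- exp_0; apply Rnot_lt_le; intros Hc; apply exp_lt_inv in Hc.
      assert (0 <= ang c z) by (apply ang_nonneg; lra); lra. }
    pose proof (Rinv_0_lt_compat _ (one_plus_sqr_pos (curv c z))) as Hi.
    rewrite eta_profile_0, arc_0 in Hmvt; unfold Rdiv in Hmvt.
    pose proof (arc_lt_smax c u).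
    assert ((exp (- ang c z) * / (1 + curv c z ^ 2) - / (1 + curv c z ^ 2)) * (u - 0) <= 0); [|lra].
    assert (exp (- ang c z) * / (1 + curv c z ^ 2) - / (1 + curv c z ^ 2) <= 0) by nra; nra. }
destruct (Rle_lt_dec u 0) as [Hu|Hu]; [|auto].
specialize (Hpos 1 Rlt_0_1).
pose proof (eta_profile_increasing c u 1); lra.
Qed.

Lemma eta_profile_limit (c : R) :
  exists B, (forall u, eta_profile c u < B) /\
    forall eps, 0 < eps -> exists M, forall u, M < u -> B - eps < eta_profile c u.
Proof.
destruct (completeness (fun y => exists u, y = eta_profile c u)) as [B [HB1 HB2]].
- exists (kappa c + smax c); intros y [u ->]; apply eta_profile_le.
- now exists (eta_profile c 0), 0.
- exists B; split.
  + intros u; apply (Rlt_le_trans _ (eta_profile c (u + 1))).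
    * apply eta_profile_increasing; lra.
    * apply HB1; now exists (u + 1).
  + intros eps He; apply NNPP; intros Hn.
    assert (B <= B - eps); [|lra].
    apply HB2; intros y [u ->].
    destruct (Rle_lt_dec (eta_profile c u) (B - eps)) as [|H]; [assumption|exfalso].
    apply Hn; exists u; intros x Hx; apply (eta_profile_increasing c) in Hx; lra.
Qed.

Lemma xi_profile_unbounded (c M : R) : exists m, 0 <= m /\ forall u, m < u -> M < xi_profile c u.
Proof.
set (B := kappa c + smax c).
(* If [xi <= M] then [xi * eta <= |M| * B], that is [ell <= A] by [profile_product]. The number [w]
   satisfies [ell w = A], and the threshold on [u] forces [c + u^2/2 > w]. *)
set (A := c + Rabs M * B / 2).
set (w := A + exp (2 * A) / 2).
exists (2 * (Rabs w + Rabs c) + 1).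
pose proof (Rabs_pos w); pose proof (Rabs_pos c); split; [lra|intros u Hu].
assert (Hw : w < c + u ^ 2 / 2).
{ pose proof (Rle_abs w); pose proof (Rle_abs (- c)); rewrite Rabs_Ropp in *; nra. }
apply ell_increasing in Hw; unfold w in Hw; rewrite ell_cancel in Hw.
pose proof (profile_product c u) as Hp.
assert (He : 0 < eta_profile c u <= B).
{ split; [|apply eta_profile_le].
  apply (Rlt_le_trans _ (kappa c)); [apply kappa_pos|apply eta_profile_ge; lra]. }
unfold A in Hw.
pose proof (Rle_abs M); pose proof (Rabs_pos M).
apply Rnot_le_lt; intros Hle.
assert (xi_profile c u * eta_profile c u <= Rabs M * B); nra.
Qed.

Lemma xi_profile_onto (c y : R) : 0 < y -> exists u, 0 <= u /\ xi_profile c u = y.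
Proof.
intros Hy; destruct (xi_profile_unbounded c y) as [m [Hm H]].
destruct (derivable_onto _ _ (is_derive_xi_profile c) 0 (m + 1) y) as [u [Hu Hyu]].
- lra.
- rewrite xi_profile_0; pose proof (kappa_pos c); assert (y < xi_profile c (m + 1)) by (apply H; lra); lra.
- exists u; split; [lra|assumption].
Qed.

(** [<X,X> = 2 ell (c + tau^2/2) - 2 c] is least at [tau = 0], where [ell_eq] gives [- kappa c ^ 2].
    With the value at the vertex, this is the isometry invariant that recovers [c]. *)
Lemma mink_curve_ge (c s : R) : - kappa c ^ 2 <= mink (curve c s) (curve c s).
Proof.
rewrite mink_lc; unfold curve; rewrite xi_lc, eta_lc.
pose proof (profile_product c (tau c s)) as H; pose proof (ell_eq c).
assert (ell c <= ell (c + tau c s ^ 2 / 2)); [|nra].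
destruct (Req_dec (tau c s) 0) as [-> | Hn].
- replace (c + 0 ^ 2 / 2) with c by (simpl; field); lra.
- left; apply ell_increasing; pose proof (pow2_gt_0 _ Hn); lra.
Qed.

Lemma mink_curve_vertex (c : R) : mink (curve c 0) (curve c 0) = - kappa c ^ 2.
Proof.
rewrite mink_lc; unfold curve; rewrite xi_lc, eta_lc.
rewrite tau_0, xi_profile_0, eta_profile_0; field.
Qed.

Lemma smax_pos (c : R) : 0 < smax c.
Proof. pose proof (arc_lt_smax c 0) as H; now rewrite arc_0 in H. Qed.

Definition reflect (q : pt) : pt := (- fst q, snd q).

Lemma curve_opp (c s : R) : - smax c < s < smax c -> curve c (- s) = reflect (curve c s).
Proof.
intros Hs; unfold curve, reflect, lc; rewrite tau_opp, xi_profile_opp, eta_profile_opp by assumption.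
simpl; f_equal; field.
Qed.

Lemma is_derive_ang_tau (c s : R) : - smax c < s < smax c ->
  is_derive (fun s => ang c (tau c s)) s (curv c (tau c s)).
Proof.
intros Hs; evar_last.
- apply (is_derive_comp (ang c) (tau c)); [apply is_derive_ang|now apply is_derive_tau].
- unfold scal; simpl; unfold mult; simpl.
  pose proof (one_plus_sqr_pos (curv c (tau c s))) as H; simpl in H; field; lra.
Qed.

Lemma is_derive_xi_curve (c s : R) : - smax c < s < smax c ->
  is_derive (fun s => xi_profile c (tau c s)) s (exp (ang c (tau c s))).
Proof.
intros Hs; evar_last.
- apply (is_derive_comp (xi_profile c) (tau c)); [apply is_derive_xi_profile|now apply is_derive_tau].
- unfold scal; simpl; unfold mult; simpl.
  pose proof (one_plus_sqr_pos (curv c (tau c s))) as H; simpl in H; field; lra.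
Qed.

Lemma is_derive_eta_curve (c s : R) : - smax c < s < smax c ->
  is_derive (fun s => eta_profile c (tau c s)) s (exp (- ang c (tau c s))).
Proof.
intros Hs; evar_last.
- apply (is_derive_comp (eta_profile c) (tau c)); [apply is_derive_eta_profile|now apply is_derive_tau].
- unfold scal; simpl; unfold mult; simpl.
  pose proof (one_plus_sqr_pos (curv c (tau c s))) as H; simpl in H; field; lra.
Qed.

(** * Linear isometries *)

(** For [C <> 0] these are all the linear isometries: boosts up to sign when [b] is true, and their
    compositions with [y -> - y], which exchanges [xi] and [eta], when [b] is false. *)
Definition lmap (b : bool) (C : R) (q : pt) : pt :=
  if b then lc (C * xi q) (/ C * eta q) else lc (C * eta q) (/ C * xi q).

Lemma lmap_lorentz (b : bool) (C : R) : C <> 0 -> lorentz (lmap b C).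
Proof.
intros HC p q; rewrite !mink_lc; destruct b; unfold lmap; rewrite !xi_lc, !eta_lc; field; assumption.
Qed.

(** With the exchange of coordinates the two factors cancel, so that [lmap false C] is an
    involution. *)
Lemma lmap_inv (b : bool) (C : R) (q : pt) :
  C <> 0 -> lmap b (if b then / C else C) (lmap b C q) = q.
Proof.
intros HC; rewrite <- (lc_xi_eta q) at 2.
destruct b; unfold lmap; rewrite xi_lc, eta_lc; f_equal; field; assumption.
Qed.

(** Isometries of the Minkowski form distort Euclidean distances; this Lipschitz constant is what
    transports the notions of asymptote and of going to infinity. *)
Lemma enorm_lmap_le (b : bool) (C : R) (q : pt) :
  enorm (lmap b C q) <= (2 * (Rabs C + Rabs (/ C))) * enorm q.
Proof.
pose proof (abs_xi_le_enorm q); pose proof (abs_eta_le_enorm q).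
pose proof (Rabs_pos C); pose proof (Rabs_pos (/ C)).
destruct b; unfold lmap; (eapply Rle_trans; [apply enorm_lc_le|]); rewrite !Rabs_mult; nra.
Qed.

Lemma lmap_psub_ray (b : bool) (C t : R) (q p v : pt) :
  psub (lmap b C q) (padd (lmap b C p) (pscal t (lmap b C v))) =
  lmap b C (psub q (padd p (pscal t v))).
Proof.
destruct b, q, p, v; unfold lmap, psub, padd, pscal, lc, xi, eta; simpl; f_equal; unfold Rdiv; ring.
Qed.

Lemma near_ray_lmap (b : bool) (C : R) (p v q : pt) (eps : R) :
  near_ray p v q (eps / (2 * (Rabs C + Rabs (/ C)))) -> C <> 0 ->
  near_ray (lmap b C p) (lmap b C v) (lmap b C q) eps.
Proof.
intros [t [Ht H]] HC; exists t; split; [assumption|].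
rewrite lmap_psub_ray; eapply Rle_lt_trans; [apply enorm_lmap_le|].
pose proof (Rabs_pos_lt C HC); pose proof (Rabs_pos (/ C)).
set (m := 2 * (Rabs C + Rabs (/ C))) in *.
assert (Hm : 0 < m) by (unfold m; lra).
apply (Rmult_lt_compat_l m) in H; [|assumption].
replace (m * (eps / m)) with eps in H by (field; lra); assumption.
Qed.

(** The Lipschitz bound applied to the inverse map, whose parameter is [C']. *)
Lemma enorm_lmap_gt (b : bool) (C M : R) (q : pt) : C <> 0 ->
  (let C' := if b then / C else C in 2 * (Rabs C' + Rabs (/ C')) * M < enorm q) ->
  M < enorm (lmap b C q).
Proof.
intros HC H; cbv zeta in H.
assert (HC' : (if b then / C else C) <> 0) by (destruct b; [now apply Rinv_neq_0_compat|assumption]).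
rewrite <- (lmap_inv b C q HC) in H.
pose proof (enorm_lmap_le b (if b then / C else C) (lmap b C q)).
set (C' := if b then / C else C) in *.
pose proof (Rabs_pos_lt C' HC'); pose proof (Rabs_pos (/ C')).
apply (Rmult_lt_reg_l (2 * (Rabs C' + Rabs (/ C')))); lra.
Qed.

Lemma in_ivl_shift (l r d s : R) : in_ivl (l - d) (r - d) s <-> in_ivl l r (s + d).
Proof. unfold in_ivl; simpl; lra. Qed.

Lemma right_end_along_lmap (X : R -> pt) (l r : R) (p v : pt) (b : bool) (C d : R) : C <> 0 ->
  right_end_along X l r p v ->
  right_end_along (fun s => lmap b C (X (s + d))) (l - d) (r - d) (lmap b C p) (lmap b C v).
Proof.
intros HC [H1 H2]; split.
- intros M.
  destruct (H1 (let C' := if b then / C else C in 2 * (Rabs C' + Rabs (/ C')) * M)) as [s1 [Hs1 H]].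
  exists (s1 - d); split; [apply in_ivl_shift; now replace (s1 - d + d) with s1 by ring|].
  intros s Hs; apply in_ivl_shift, H in Hs; now apply enorm_lmap_gt.
- intros eps He.
  assert (Hm : 0 < 2 * (Rabs C + Rabs (/ C))).
  { pose proof (Rabs_pos_lt C HC); pose proof (Rabs_pos (/ C)); lra. }
  destruct (H2 (eps / (2 * (Rabs C + Rabs (/ C))))) as [s1 [Hs1 H]]; [now apply Rdiv_lt_0_compat|].
  exists (s1 - d); split; [apply in_ivl_shift; now replace (s1 - d + d) with s1 by ring|].
  intros s Hs; apply in_ivl_shift, H in Hs; now apply near_ray_lmap.
Qed.

Lemma left_end_along_lmap (X : R -> pt) (l r : R) (p v : pt) (b : bool) (C d : R) : C <> 0 ->
  left_end_along X l r p v ->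
  left_end_along (fun s => lmap b C (X (s + d))) (l - d) (r - d) (lmap b C p) (lmap b C v).
Proof.
intros HC [H1 H2]; split.
- intros M.
  destruct (H1 (let C' := if b then / C else C in 2 * (Rabs C' + Rabs (/ C')) * M)) as [s1 [Hs1 H]].
  exists (s1 - d); split; [apply in_ivl_shift; now replace (s1 - d + d) with s1 by ring|].
  intros s Hs; apply in_ivl_shift, H in Hs; now apply enorm_lmap_gt.
- intros eps He.
  assert (Hm : 0 < 2 * (Rabs C + Rabs (/ C))).
  { pose proof (Rabs_pos_lt C HC); pose proof (Rabs_pos (/ C)); lra. }
  destruct (H2 (eps / (2 * (Rabs C + Rabs (/ C))))) as [s1 [Hs1 H]]; [now apply Rdiv_lt_0_compat|].
  exists (s1 - d); split; [apply in_ivl_shift; now replace (s1 - d + d) with s1 by ring|].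
  intros s Hs; apply in_ivl_shift, H in Hs; now apply near_ray_lmap.
Qed.

Lemma asymptotic_to_cone_lmap (X : R -> pt) (l r : R) (b : bool) (C d : R) : C <> 0 ->
  asymptotic_to_cone X l r ->
  asymptotic_to_cone (fun s => lmap b C (X (s + d))) (l - d) (r - d).
Proof.
intros HC [p [v1 [v2 [Hv [Hl Hr]]]]].
exists (lmap b C p), (lmap b C v1), (lmap b C v2).
split; [|split; [now apply left_end_along_lmap|now apply right_end_along_lmap]].
destruct v1 as [x1 y1], v2 as [x2 y2]; simpl in Hv.
(* The map has determinant 1 or -1 according to [b], so it preserves linear independence of the two
   directions. *)
intros H0; apply Hv; transitivity (if b then 0 else - 0); [|destruct b; ring].
destruct b; rewrite <- H0; unfold lmap, lc, xi, eta; simpl; field; assumption.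
Qed.

(** The criterion applies with [p = C exp(angle)] when [b] is true. Exchanging the coordinates
    inverts the exponential, giving [p = C exp(- angle)] and the opposite curvature: this is how
    negatively curved shrinkers are reached. *)
Lemma shrinker_lmap_curve (b : bool) (C c d : R) : C <> 0 ->
  shrinker (fun s => lmap b C (curve c (s + d))) (- smax c - d) (smax c - d) /\
  forall s, in_ivl (- smax c - d) (smax c - d) s ->
    curvature (fun s => lmap b C (curve c (s + d))) s =
    if b then curv c (tau c (s + d)) else - curv c (tau c (s + d)).
Proof.
intros HC.
assert (Hlt : Rbar_lt (- smax c - d) (smax c - d)) by (pose proof (smax_pos c); simpl; lra).
assert (Hin : forall s, in_ivl (- smax c - d) (smax c - d) s -> - smax c < s + d < smax c)
  by (intros s Hs; apply in_ivl_shift; assumption).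
assert (Shift : forall (f : R -> R) (s x : R), is_derive f (s + d) x -> is_derive (fun s : R => f (s + d)) s x).
{ intros f s x Hf; evar_last.
  - apply (is_derive_comp f (fun s => s + d)); [exact Hf|]. auto_derive; [trivial|reflexivity].
  - apply Rmult_1_l. }
set (th := fun s => ang c (tau c (s + d))).
set (k := fun s => curv c (tau c (s + d))).
assert (Dth : forall s, in_ivl (- smax c - d) (smax c - d) s -> is_derive th s (k s)).
{ intros s Hs; apply (Shift (fun s => ang c (tau c s))), is_derive_ang_tau, Hin, Hs. }
assert (Dxi : forall A s, in_ivl (- smax c - d) (smax c - d) s ->
  is_derive (fun s => A * xi_profile c (tau c (s + d))) s (A * exp (th s))).
{ intros A s Hs; apply is_derive_scal.
  apply (Shift (fun s => xi_profile c (tau c s))), is_derive_xi_curve, Hin, Hs. }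
assert (Deta : forall A s, in_ivl (- smax c - d) (smax c - d) s ->
  is_derive (fun s => A * eta_profile c (tau c (s + d))) s (A * exp (- th s))).
{ intros A s Hs; apply is_derive_scal.
  apply (Shift (fun s => eta_profile c (tau c s))), is_derive_eta_curve, Hin, Hs. }
assert (Hep : forall s, exp (th s) <> 0) by (intros s; apply Rgt_not_eq, exp_pos).
destruct b.
- replace (fun s => lmap true C (curve c (s + d)))
    with (fun s => lc (C * xi_profile c (tau c (s + d))) (/ C * eta_profile c (tau c (s + d)))).
  2: { apply functional_extensionality; intros s; unfold lmap, curve; now rewrite xi_lc, eta_lc. }
  assert (H1 : forall s, in_ivl (- smax c - d) (smax c - d) s ->
    is_derive (fun s => / C * eta_profile c (tau c (s + d))) s (/ (C * exp (th s)))).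
  { intros s Hs; rewrite Rinv_mult, <- exp_Ropp; auto. }
  assert (H2 : forall s, C * exp (th s) <> 0) by (intros s; apply Rmult_integral_contrapositive; auto).
  assert (H3 : forall s, in_ivl (- smax c - d) (smax c - d) s ->
    is_derive (fun s => C * exp (th s)) s (k s * (C * exp (th s)))).
  { intros s Hs; replace (k s * (C * exp (th s))) with (C * (k s * exp (th s))) by ring.
    apply is_derive_scal, (is_derive_comp exp th); [apply is_derive_exp|auto]. }
  assert (H4 : forall s, / C * eta_profile c (tau c (s + d)) * (C * exp (th s)) -
    C * xi_profile c (tau c (s + d)) * / (C * exp (th s)) = 2 * k s).
  { intros s; unfold eta_profile, xi_profile; fold (th s) (k s); rewrite exp_Ropp; field; auto. }
  split; [apply (shrinker_lc _ _ _ _ (fun s => C * exp (th s)) k); auto|].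
  intros s Hs; apply (curvature_lc _ _ _ _ (fun s => C * exp (th s)) k) with (4 := H3); auto.
- replace (fun s => lmap false C (curve c (s + d)))
    with (fun s => lc (C * eta_profile c (tau c (s + d))) (/ C * xi_profile c (tau c (s + d)))).
  2: { apply functional_extensionality; intros s; unfold lmap, curve; now rewrite xi_lc, eta_lc. }
  assert (H1 : forall s, in_ivl (- smax c - d) (smax c - d) s ->
    is_derive (fun s => / C * xi_profile c (tau c (s + d))) s (/ (C * exp (- th s)))).
  { intros s Hs; rewrite Rinv_mult, <- exp_Ropp, Ropp_involutive; auto. }
  assert (H2 : forall s, C * exp (- th s) <> 0).
  { intros s; apply Rmult_integral_contrapositive; split; [auto|apply Rgt_not_eq, exp_pos]. }
  assert (H3 : forall s, in_ivl (- smax c - d) (smax c - d) s ->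
    is_derive (fun s => C * exp (- th s)) s (- k s * (C * exp (- th s)))).
  { intros s Hs; replace (- k s * (C * exp (- th s))) with (C * (- k s * exp (- th s))) by ring.
    apply is_derive_scal, (is_derive_comp exp (fun s => - th s)); [apply is_derive_exp|].
    apply (is_derive_opp th); auto. }
  assert (H4 : forall s, / C * xi_profile c (tau c (s + d)) * (C * exp (- th s)) -
    C * eta_profile c (tau c (s + d)) * / (C * exp (- th s)) = 2 * - k s).
  { intros s; unfold eta_profile, xi_profile; fold (th s) (k s); rewrite exp_Ropp; field; auto. }
  split; [apply (shrinker_lc _ _ _ _ (fun s => C * exp (- th s)) (fun s => - k s)); auto|].
  intros s Hs; apply (curvature_lc _ _ _ _ (fun s => C * exp (- th s)) (fun s => - k s)) with (4 := H3); auto.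
Qed.

(** * Properties of the family *)

(** Translates large [tau] into arc length close to the right end, with [arc c m] as threshold. *)
Lemma right_end_tau (c m : R) (P : R -> Prop) : (forall u, m < u -> P u) ->
  exists s1, in_ivl (- smax c) (smax c) s1 /\ forall s, in_ivl s1 (smax c) s -> P (tau c s).
Proof.
intros H; exists (arc c m); split.
- split; [apply arc_gt_opp_smax|apply arc_lt_smax].
- intros s [Hs1 Hs2]; simpl in Hs1, Hs2; apply H.
  pose proof (arc_gt_opp_smax c m).
  apply (increasing_lt_inv _ (arc_increasing c)); rewrite arc_tau; lra.
Qed.

(** [B] is the supremum of [eta]. The ray starts at [(0, - B)], on the y-axis, so that the reflected
    ray at the left end has the same apex. *)
Lemma curve_right_end (c : R) :
  exists B, right_end_along (curve c) (- smax c) (smax c) (lc (- B) B) (lc 1 0).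
Proof.
destruct (eta_profile_limit c) as [B [HB Hlim]]; exists B; split.
- intros M; destruct (xi_profile_unbounded c (2 * Rabs M)) as [m [_ Hm]].
  apply (right_end_tau c m (fun u => M < enorm (lc (xi_profile c u) (eta_profile c u)))).
  intros u Hu; apply Hm in Hu.
  pose proof (abs_xi_le_enorm (lc (xi_profile c u) (eta_profile c u))) as H; rewrite xi_lc in H.
  pose proof (Rle_abs (xi_profile c u)); pose proof (Rle_abs M); lra.
- intros eps He; destruct (Hlim eps He) as [m Hm].
  apply (right_end_tau c (Rmax 0 m)
    (fun u => near_ray (lc (- B) B) (lc 1 0) (lc (xi_profile c u) (eta_profile c u)) eps)).
  intros u Hu; pose proof (Rmax_l 0 m); pose proof (Rmax_r 0 m).
  (* The point of the ray with the same [xi], leaving only the gap [eta - B]. The parameter is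
     nonnegative since [xi >= - kappa c] and [kappa c = eta_profile c 0 < B]. *)
  exists (xi_profile c u + B); split.
  + assert (Hu0 : 0 <= u) by lra; apply (xi_profile_ge c) in Hu0.
    pose proof (HB 0) as HB0; rewrite eta_profile_0 in HB0; lra.
  + replace (psub _ _) with (lc 0 (eta_profile c u - B))
      by (unfold psub, padd, pscal, lc; simpl; f_equal; field).
    eapply Rle_lt_trans; [apply enorm_lc_le|]; rewrite Rabs_R0.
    specialize (HB u); assert (B - eps < eta_profile c u) by (apply Hm; lra).
    rewrite Rabs_left by lra; lra.
Qed.

Lemma enorm_reflect (q : pt) : enorm (reflect q) = enorm q.
Proof. unfold enorm, reflect; simpl; f_equal; ring. Qed.

Lemma near_ray_reflect (p v q : pt) (eps : R) :
  near_ray p v q eps -> near_ray (reflect p) (reflect v) (reflect q) eps.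
Proof.
intros [t [Ht H]]; exists t; split; [assumption|].
rewrite <- enorm_reflect in H.
replace (psub _ _) with (reflect (psub q (padd p (pscal t v)))); [assumption|].
unfold psub, padd, pscal, reflect; simpl; f_equal; ring.
Qed.

Lemma left_end_of_right_end (X : R -> pt) (S : R) (p v : pt) :
  (forall s, in_ivl (- S) S s -> X (- s) = reflect (X s)) ->
  right_end_along X (- S) S p v -> left_end_along X (- S) S (reflect p) (reflect v).
Proof.
intros HX [H1 H2].
assert (W : forall P Q : pt -> Prop, (forall q, P q -> Q (reflect q)) ->
  (exists s1, in_ivl (- S) S s1 /\ forall s, in_ivl s1 S s -> P (X s)) ->
  exists s1, in_ivl (- S) S s1 /\ forall s, in_ivl (- S) s1 s -> Q (X s)).
{ intros P Q HPQ [s1 [Hs1 H]]; exists (- s1); unfold in_ivl in *; simpl in *; split; [lra|].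
  intros s Hs; rewrite <- (Ropp_involutive s), HX by lra. apply HPQ, H; lra. }
split.
- intros M; apply (W (fun q => M < enorm q) (fun q => M < enorm q)); [|apply H1].
  intros q; now rewrite enorm_reflect.
- intros eps He; apply (W (fun q => near_ray p v q eps)
    (fun q => near_ray (reflect p) (reflect v) q eps)); [|now apply H2].
  intros q; apply near_ray_reflect.
Qed.

Lemma curve_asymptotic (c : R) : asymptotic_to_cone (curve c) (- smax c) (smax c).
Proof.
destruct (curve_right_end c) as [B HB].
exists (lc (- B) B), (reflect (lc 1 0)), (lc 1 0); split; [|split; [|assumption]].
- unfold reflect, lc; simpl; lra.
- replace (lc (- B) B) with (reflect (lc (- B) B)) by (unfold reflect, lc; simpl; f_equal; field).
  apply left_end_of_right_end; [|assumption].
  intros s Hs; now apply curve_opp.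
Qed.

Lemma curve_lmap (c : R) :
  curve c = (fun s => lmap true 1 (curve c (s + 0))).
Proof.
apply functional_extensionality; intros s; rewrite Rplus_0_r; unfold lmap.
rewrite Rinv_1, !Rmult_1_l; now rewrite lc_xi_eta.
Qed.

Lemma shrinker_curve (c : R) : shrinker (curve c) (- smax c) (smax c).
Proof.
destruct (shrinker_lmap_curve true 1 c 0 R1_neq_R0) as [H _].
now rewrite <- curve_lmap, !Rminus_0_r in H.
Qed.

Lemma curvature_curve (c s : R) : in_ivl (- smax c) (smax c) s ->
  curvature (curve c) s = curv c (tau c s).
Proof.
destruct (shrinker_lmap_curve true 1 c 0 R1_neq_R0) as [_ H].
rewrite <- curve_lmap, !Rminus_0_r in H.
intros Hs; apply H in Hs; now rewrite Rplus_0_r in Hs.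
Qed.

Lemma curve_convex (c : R) : convex_curve (curve c) (- smax c) (smax c).
Proof. left; intros s Hs; rewrite curvature_curve by assumption; apply curv_pos. Qed.

(** * Maximality of the model curves *)

Lemma enorm_le_abs (q : pt) : enorm q <= Rabs (fst q) + Rabs (snd q).
Proof.
pose proof (Rabs_pos (fst q)); pose proof (Rabs_pos (snd q)).
unfold enorm; rewrite <- (sqrt_pow2 (Rabs (fst q) + Rabs (snd q))) by lra.
apply sqrt_le_1_alt.
pose proof (pow2_abs (fst q)); pose proof (pow2_abs (snd q)); nra.
Qed.

Lemma locally_bounded (X : R -> pt) (s0 : R) :
  ex_derive (fun t => fst (X t)) s0 -> ex_derive (fun t => snd (X t)) s0 ->
  exists M, locally s0 (fun s => enorm (X s) <= M).
Proof.
intros H1 H2; exists (Rabs (fst (X s0)) + 1 + (Rabs (snd (X s0)) + 1)).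
apply (ex_derive_continuous (fun t => fst (X t)) s0) in H1.
apply (ex_derive_continuous (fun t => snd (X t)) s0) in H2.
apply (proj1 (filterlim_locally _ _)) with (eps := mkposreal 1 Rlt_0_1) in H1.
apply (proj1 (filterlim_locally _ _)) with (eps := mkposreal 1 Rlt_0_1) in H2.
generalize (filter_and _ _ H1 H2); apply filter_imp; intros s [Ha Hb].
change (Rabs (fst (X s) - fst (X s0)) < 1) in Ha.
change (Rabs (snd (X s) - snd (X s0)) < 1) in Hb.
pose proof (enorm_le_abs (X s)).
pose proof (Rabs_triang_inv (fst (X s)) (fst (X s0))).
pose proof (Rabs_triang_inv (snd (X s)) (snd (X s0))).
lra.
Qed.

(** An extension past a finite endpoint would be differentiable there, hence bounded nearby, whereas
    [X] leaves every bounded set. *)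
Lemma max_shrinker_of_ends (X : R -> pt) (l r : R) (p1 v1 p2 v2 : pt) :
  shrinker X l r -> left_end_along X l r p1 v1 -> right_end_along X l r p2 v2 ->
  max_shrinker X l r.
Proof.
intros HX [Hl _] [Hr _]; split; [assumption|].
intros Y l' r' [[Hlr [HC2 _]] _] Hl' Hr' HXY.
assert (Hlr0 : l < r) by exact (proj1 (proj1 HX)).
split.
- destruct (Rbar_le_lt_or_eq_dec _ _ Hl') as [Hlt|]; [exfalso|assumption].
  destruct (HC2 l) as [D1 [D2 _]].
  { split; [assumption|]. apply (Rbar_lt_le_trans _ r); assumption. }
  destruct (locally_bounded Y l D1 D2) as [M [d HM]].
  destruct (Hl M) as [s1 [[Hs1 Hs1'] H]]; simpl in Hs1, Hs1'.
  set (s := l + Rmin (d / 2) ((s1 - l) / 2)).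
  pose proof (cond_pos d).
  assert (Hs : 0 < Rmin (d / 2) ((s1 - l) / 2)) by (apply Rmin_glb_lt; lra).
  pose proof (Rmin_l (d / 2) ((s1 - l) / 2)); pose proof (Rmin_r (d / 2) ((s1 - l) / 2)).
  assert (M < enorm (X s)) by (apply H; split; unfold s; simpl; lra).
  assert (enorm (Y s) <= M).
  { apply HM; change (Rabs (s - l) < d); unfold s; rewrite Rabs_pos_eq; lra. }
  rewrite HXY in *; [lra|split; unfold s; simpl; lra].
- destruct (Rbar_le_lt_or_eq_dec _ _ Hr') as [Hlt|]; [exfalso|now symmetry].
  destruct (HC2 r) as [D1 [D2 _]].
  { split; [|assumption]. apply (Rbar_le_lt_trans _ l); assumption. }
  destruct (locally_bounded Y r D1 D2) as [M [d HM]].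
  destruct (Hr M) as [s1 [[Hs1 Hs1'] H]]; simpl in Hs1, Hs1'.
  set (s := r - Rmin (d / 2) ((r - s1) / 2)).
  pose proof (cond_pos d).
  assert (Hs : 0 < Rmin (d / 2) ((r - s1) / 2)) by (apply Rmin_glb_lt; lra).
  pose proof (Rmin_l (d / 2) ((r - s1) / 2)); pose proof (Rmin_r (d / 2) ((r - s1) / 2)).
  assert (M < enorm (X s)) by (apply H; split; unfold s; simpl; lra).
  assert (enorm (Y s) <= M).
  { apply HM; change (Rabs (s - r) < d); unfold s; rewrite Rabs_minus_sym, Rabs_pos_eq; lra. }
  rewrite HXY in *; [lra|split; unfold s; simpl; lra].
Qed.

Lemma curve_max_shrinker (c : R) : max_shrinker (curve c) (- smax c) (smax c).
Proof.
destruct (curve_asymptotic c) as [p [v1 [v2 [_ [Hl Hr]]]]].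
apply (max_shrinker_of_ends _ _ _ p v1 p v2); auto using shrinker_curve.
Qed.

(** * From the definition of a shrinker to scalar equations *)

Lemma shrinker_derivatives (X : R -> pt) (l r : Rbar) (s : R) :
  shrinker X l r -> in_ivl l r s ->
  let p := xi (tangent X s) in let k := curvature X s in
  p <> 0 /\ eta (tangent X s) = / p /\
  is_derive (fun s => xi (X s)) s p /\ is_derive (fun s => eta (X s)) s (/ p) /\
  is_derive (fun s => xi (tangent X s)) s (k * p) /\
  eta (X s) * p - xi (X s) * / p = 2 * k.
Proof.
intros [[Hlr [HC2 Hunit]] Hk] Hs p k.
assert (Hpq : forall s, in_ivl l r s -> xi (tangent X s) * eta (tangent X s) = 1).
{ intros t Ht; rewrite <- (Hunit t Ht), mink_lc; field. }
assert (Hp : p <> 0).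
{ intros H0; specialize (Hpq s Hs); fold p in Hpq; rewrite H0 in Hpq; lra. }
assert (Hq : eta (tangent X s) = / p).
{ apply (Rmult_eq_reg_l p); [|assumption]. rewrite Rinv_r by assumption; apply (Hpq s Hs). }
assert (HT : tangent X s = lc p (/ p)) by (rewrite <- Hq; symmetry; apply lc_xi_eta).
destruct (HC2 s Hs) as [D1 [D2 [D3 D4]]].
apply Derive_correct in D1; apply Derive_correct in D2.
apply Derive_correct in D3; apply Derive_correct in D4.
set (a := Derive (fun t => fst (tangent X t)) s) in *.
set (b := Derive (fun t => snd (tangent X t)) s) in *.
assert (E1 : is_derive (fun s => xi (tangent X s)) s (a + b)) by exact (is_derive_plus _ _ _ _ _ D3 D4).
assert (E2 : is_derive (fun s => eta (tangent X s)) s (a - b)) by exact (is_derive_minus _ _ _ _ _ D3 D4).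
(* The derivative of [<T,T> = 1], an identity that holds only locally around [s]. It makes the [xi]
   and [eta] parts of [- <T_s,N>] equal, whence [k = (a + b) / p]. *)
assert (Hort : (a + b) * / p + p * (a - b) = 0).
{ assert (E3 : is_derive (fun s => xi (tangent X s) * eta (tangent X s)) s ((a + b) * / p + p * (a - b))).
  { rewrite <- Hq; apply (is_derive_mult (fun s => xi (tangent X s)) (fun s => eta (tangent X s)));
      [assumption|assumption|apply Rmult_comm]. }
  apply is_derive_unique in E3; rewrite <- E3.
  rewrite (Derive_ext_loc _ (fun _ => 1)); [apply Derive_const|].
  apply (filter_imp (in_ivl l r)); [exact Hpq|now apply locally_in_ivl]. }
assert (Hkp : k = (a + b) * / p).
{ unfold k, curvature, normal; change (dcurve (tangent X) s) with (a, b).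
  rewrite HT; unfold mink, hmul, lc; simpl; lra. }
refine (conj Hp (conj Hq (conj _ (conj _ (conj _ _))))).
- exact (is_derive_plus _ _ _ _ _ D1 D2).
- rewrite <- Hq; exact (is_derive_minus _ _ _ _ _ D1 D2).
- rewrite Hkp, Rmult_assoc, Rinv_l, Rmult_1_r by assumption; exact E1.
- unfold k; rewrite <- (Hk s Hs); unfold normal; rewrite HT.
  unfold mink, hmul, lc, xi, eta; simpl; field; assumption.
Qed.

(** * Classification *)

Section ShrinkerInvariants.

Variables (X : R -> pt) (l r : Rbar).
Hypothesis shrX : shrinker X l r.

Let p (s : R) : R := xi (tangent X s).
(** [k] is [<X,N>] and [t] is [<X,T>], expressed through [X] and [p]. Unlike [curvature], which
    already contains second derivatives, these are visibly differentiable; the shrinker equation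
    identifies [k] with the curvature. *)
Let k (s : R) : R := (eta (X s) * p s - xi (X s) * / p s) / 2.
Let t (s : R) : R := (eta (X s) * p s + xi (X s) * / p s) / 2.

Lemma shrinker_curvature_eq (s : R) : in_ivl l r s -> curvature X s = k s.
Proof.
intros Hs; destruct (shrinker_derivatives X l r s shrX Hs) as [_ [_ [_ [_ [_ H]]]]].
unfold k, p; lra.
Qed.

Lemma shrinker_tangent_neq_0 (s : R) : in_ivl l r s -> p s <> 0.
Proof. intros Hs; apply (shrinker_derivatives X l r s shrX Hs). Qed.

Lemma is_derive_shrinker_tangent (s : R) : in_ivl l r s -> is_derive p s (k s * p s).
Proof.
intros Hs; rewrite <- shrinker_curvature_eq by assumption.
apply (shrinker_derivatives X l r s shrX Hs).
Qed.

Let dxi (s : R) : in_ivl l r s -> is_derive (fun s => xi (X s)) s (p s).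
Proof. intros Hs; apply (shrinker_derivatives X l r s shrX Hs). Qed.

Let deta (s : R) : in_ivl l r s -> is_derive (fun s => eta (X s)) s (/ p s).
Proof. intros Hs; apply (shrinker_derivatives X l r s shrX Hs). Qed.

Let detap (s : R) : in_ivl l r s ->
  is_derive (fun s => eta (X s) * p s) s (1 + eta (X s) * (k s * p s)).
Proof.
intros Hs; evar_last.
- apply (is_derive_mult (fun s => eta (X s)) p);
    [now apply deta|now apply is_derive_shrinker_tangent|apply Rmult_comm].
- change (/ p s * p s + eta (X s) * (k s * p s) = 1 + eta (X s) * (k s * p s)).
  rewrite Rinv_l; [reflexivity|now apply shrinker_tangent_neq_0].
Qed.

Let dxip (s : R) : in_ivl l r s ->
  is_derive (fun s => xi (X s) * / p s) s (1 - xi (X s) * (k s * / p s)).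
Proof.
intros Hs; pose proof (shrinker_tangent_neq_0 s Hs) as Hp; evar_last.
- apply (is_derive_mult (fun s => xi (X s)) (fun s => / p s));
    [now apply dxi|now apply is_derive_inv; [apply is_derive_shrinker_tangent|]|apply Rmult_comm].
- change (p s * / p s + xi (X s) * (- (k s * p s) / p s ^ 2) = 1 - xi (X s) * (k s * / p s)).
  field; assumption.
Qed.

Lemma is_derive_shrinker_tau (s : R) : in_ivl l r s -> is_derive t s (1 + k s ^ 2).
Proof.
intros Hs.
replace (1 + k s ^ 2)
  with ((1 + eta (X s) * (k s * p s) + (1 - xi (X s) * (k s * / p s))) * / 2)
  by (unfold k; field; now apply shrinker_tangent_neq_0).
apply (is_derive_scal_l (fun s => eta (X s) * p s + xi (X s) * / p s) s _ (/ 2)).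
apply (is_derive_plus (fun s => eta (X s) * p s)); auto.
Qed.

Lemma is_derive_shrinker_curvature (s : R) : in_ivl l r s -> is_derive k s (k s * t s).
Proof.
intros Hs.
replace (k s * t s)
  with ((1 + eta (X s) * (k s * p s) - (1 - xi (X s) * (k s * / p s))) * / 2)
  by (unfold t; field; now apply shrinker_tangent_neq_0).
apply (is_derive_scal_l (fun s => eta (X s) * p s - xi (X s) * / p s) s _ (/ 2)).
apply (is_derive_minus (fun s => eta (X s) * p s)); auto.
Qed.

Lemma mink_shrinker (s : R) : in_ivl l r s -> mink (X s) (X s) = t s ^ 2 - k s ^ 2.
Proof.
intros Hs; rewrite mink_lc; unfold t, k; field; now apply shrinker_tangent_neq_0.
Qed.

Lemma shrinker_first_integral :
  exists c0, forall s, in_ivl l r s -> curvature X s * exp (- mink (X s) (X s) / 2) = c0.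
Proof.
destruct (in_ivl_nonempty l r) as [s0 Hs0]; [apply shrX|].
set (f := fun s => k s * exp (xi (X s) * eta (X s) * - / 2)).
exists (f s0); intros s Hs.
rewrite shrinker_curvature_eq by assumption.
transitivity (f s); [unfold f; rewrite mink_lc; do 2 f_equal; field|].
apply (constant_on_ivl f l r); [|assumption|assumption].
clear s Hs; intros s Hs; unfold f.
pose proof (shrinker_tangent_neq_0 s Hs) as Hp.
evar_last.
- apply (is_derive_mult k (fun s => exp (xi (X s) * eta (X s) * - / 2)));
    [now apply is_derive_shrinker_curvature| |apply Rmult_comm].
  apply (is_derive_comp exp (fun s => xi (X s) * eta (X s) * - / 2)); [apply is_derive_exp|].
  apply (is_derive_scal_l (fun s => xi (X s) * eta (X s)) s
    (p s * eta (X s) + xi (X s) * / p s) (- / 2)).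
  apply (is_derive_mult (fun s => xi (X s)) (fun s => eta (X s))); [auto|auto|apply Rmult_comm].
- unfold plus, mult, scal; simpl; unfold mult; simpl; unfold t; field; assumption.
Qed.

(** With [k = 0] the tangent coordinate [p] is constant, so both light-like coordinates are affine
    in [s]. *)
Lemma shrinker_flat_on_line :
  (forall s, in_ivl l r s -> curvature X s = 0) -> on_line X l r.
Proof.
intros H0.
assert (Hk : forall s, in_ivl l r s -> k s = 0)
  by (intros s Hs; rewrite <- shrinker_curvature_eq; auto).
destruct (in_ivl_nonempty l r) as [s0 Hs0]; [apply shrX|].
assert (Hp : forall s, in_ivl l r s -> p s = p s0).
{ intros s Hs; apply (constant_on_ivl p l r); auto.
  intros z Hz; evar_last; [now apply is_derive_shrinker_tangent|].
  rewrite Hk by assumption; apply Rmult_0_l. }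
exists (X s0), (lc (p s0) (/ p s0)); split.
- intros Hv; apply (shrinker_tangent_neq_0 s0 Hs0).
  rewrite <- (xi_lc (p s0) (/ p s0)), Hv; unfold xi; simpl; ring.
- intros s Hs; exists (s - s0).
  assert (Lin : forall (f : R -> R) (m : R), (forall z, in_ivl l r z -> is_derive f z m) ->
     f s = f s0 + (s - s0) * m).
  { intros f m Hf.
    assert (f s - s * m = f s0 - s0 * m); [|lra].
    apply (constant_on_ivl (fun s => f s - s * m) l r); auto.
    intros z Hz; evar_last.
    - apply (is_derive_minus f (fun s => s * m) z m m); [now apply Hf|].
      auto_derive; [trivial|ring].
    - change (m - m = 0); ring. }
  assert (E1 : xi (X s) = xi (X s0) + (s - s0) * p s0).
  { apply (Lin (fun s => xi (X s))); intros z Hz; rewrite <- (Hp z Hz); auto. }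
  assert (E2 : eta (X s) = eta (X s0) + (s - s0) * / p s0).
  { apply (Lin (fun s => eta (X s))); intros z Hz; rewrite <- (Hp z Hz); auto. }
  rewrite <- (lc_xi_eta (X s)), E1, E2.
  unfold lc, padd, pscal, xi, eta; simpl; f_equal; field; now apply shrinker_tangent_neq_0.
Qed.

(** The first integral makes [k] a function of [t]; two constants of motion then give [t] and [p] as
    functions of [s], and [X = t T - k N] is recovered from [t], [k] and [p]. *)
Lemma shrinker_classification (c0 : R) : c0 <> 0 ->
  (forall s, in_ivl l r s -> curvature X s * exp (- mink (X s) (X s) / 2) = c0) ->
  exists b C c d, C <> 0 /\ forall s, in_ivl l r s ->
    - smax c < s + d < smax c /\ X s = lmap b C (curve c (s + d)).
Proof.
intros Hc0 Hint.
set (c := ln (Rabs c0)).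
(* The first integral determines [|k|] from [t] with [c = ln |c0|]; the sign of [k] is that of [c0],
   hence the same along the whole curve. *)
assert (Hsg : exists sg, (sg = 1 \/ sg = -1) /\ forall s, in_ivl l r s -> k s = sg * curv c (t s)).
{ assert (Habs : forall s, in_ivl l r s -> curv c (t s) = Rabs (k s)).
  { intros s Hs; specialize (Hint s Hs).
    rewrite shrinker_curvature_eq, mink_shrinker in Hint by assumption.
    apply kappa_eq_exp.
    - apply Rabs_pos_lt; intros H0; rewrite H0 in Hint; lra.
    - unfold c; rewrite exp_plus, exp_ln by now apply Rabs_pos_lt.
      rewrite <- Hint, Rabs_mult, (Rabs_pos_eq (exp _)) by (left; apply exp_pos).
      rewrite Rmult_assoc, <- exp_plus, pow2_abs; do 2 f_equal; field. }
  assert (Hsgn : forall s, in_ivl l r s -> k s * exp (- mink (X s) (X s) / 2) = c0)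
    by (intros s Hs; rewrite <- shrinker_curvature_eq; auto).
  destruct (Rdichotomy _ _ Hc0) as [Hneg|Hpos].
  - exists (-1); split; [auto|]; intros s Hs; rewrite Habs by assumption.
    specialize (Hsgn s Hs); pose proof (exp_pos (- mink (X s) (X s) / 2)).
    rewrite Rabs_left; [ring|nra].
  - exists 1; split; [auto|]; intros s Hs; rewrite Habs by assumption.
    specialize (Hsgn s Hs); pose proof (exp_pos (- mink (X s) (X s) / 2)).
    rewrite Rabs_pos_eq; [ring|nra]. }
destruct Hsg as [sg [Hsg Hk]].
assert (Hsg2 : sg * sg = 1) by (destruct Hsg; subst; ring).
destruct (in_ivl_nonempty l r) as [s0 Hs0]; [apply shrX|].
(* The first constant of motion, the arc length offset: [t' = 1 + k^2] cancels the rate of [arc]. *)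
assert (Harc : forall s, in_ivl l r s -> arc c (t s) - s = arc c (t s0) - s0).
{ intros s Hs; apply (constant_on_ivl (fun s => arc c (t s) - s) l r); auto.
  intros z Hz; evar_last.
  - apply (is_derive_minus (fun s => arc c (t s)) (fun s => s)); [|apply is_derive_id].
    apply (is_derive_comp (arc c) t); [apply is_derive_arc|now apply is_derive_shrinker_tau].
  - change ((1 + k z ^ 2) * / (1 + curv c (t z) ^ 2) - 1 = 0).
    replace (k z ^ 2) with (curv c (t z) ^ 2)
      by (rewrite Hk by assumption; transitivity (sg * sg * curv c (t z) ^ 2); [rewrite Hsg2|]; ring).
    pose proof (one_plus_sqr_pos (curv c (t z))); field; lra. }
(* The second constant of motion, the boost [C] matching the tangents: [p' = k p], while the signed
   angle also has derivative [k]. *)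
assert (Hang : forall s, in_ivl l r s ->
  p s * exp (- (sg * ang c (t s))) = p s0 * exp (- (sg * ang c (t s0)))).
{ intros s Hs; apply (constant_on_ivl (fun s => p s * exp (- (sg * ang c (t s)))) l r); auto.
  intros z Hz; evar_last.
  - apply (is_derive_mult p (fun s => exp (- (sg * ang c (t s)))));
      [now apply is_derive_shrinker_tangent| |apply Rmult_comm].
    apply (is_derive_comp exp (fun s => - (sg * ang c (t s)))); [apply is_derive_exp|].
    apply (is_derive_opp (fun s => sg * ang c (t s))), is_derive_scal.
    apply (is_derive_comp (ang c) t); [apply is_derive_ang|now apply is_derive_shrinker_tau].
  - change (k z * p z * exp (- (sg * ang c (t z))) + p z *
      (- (sg * ((1 + k z ^ 2) * (curv c (t z) / (1 + curv c (t z) ^ 2)))) *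
       exp (- (sg * ang c (t z)))) = 0).
    replace (k z ^ 2) with (curv c (t z) ^ 2)
      by (rewrite Hk by assumption; transitivity (sg * sg * curv c (t z) ^ 2); [rewrite Hsg2|]; ring).
    rewrite Hk by assumption.
    pose proof (one_plus_sqr_pos (curv c (t z))); field; lra. }
set (C := p s0 * exp (- (sg * ang c (t s0)))) in *.
set (d := arc c (t s0) - s0) in *.
assert (HC : C <> 0).
{ apply Rmult_integral_contrapositive; split;
    [now apply shrinker_tangent_neq_0|apply Rgt_not_eq, exp_pos]. }
(* Negative curvature corresponds to the isometries that exchange [xi] and [eta]. *)
exists (if Rlt_dec 0 sg then true else false), C, c, d; split; [assumption|].
intros s Hs.
replace (s + d) with (arc c (t s)) by (specialize (Harc s Hs); lra).
split; [split; [apply arc_gt_opp_smax|apply arc_lt_smax]|].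
unfold curve; rewrite tau_arc.
assert (Hp : p s = C * exp (sg * ang c (t s))).
{ rewrite <- (Hang s Hs), Rmult_assoc, <- exp_plus, Rplus_opp_l, exp_0; ring. }
pose proof (shrinker_tangent_neq_0 s Hs) as Hp0.
assert (E1 : xi (X s) = (t s - k s) * p s) by (unfold t, k; field; assumption).
assert (E2 : eta (X s) = (t s + k s) * / p s) by (unfold t, k; field; assumption).
rewrite <- (lc_xi_eta (X s)), E1, E2, Hk, Hp by assumption.
pose proof (exp_pos (ang c (t s))).
destruct Hsg as [-> | ->]; destruct Rlt_dec; try lra; unfold lmap; rewrite xi_lc, eta_lc;
  unfold xi_profile, eta_profile.
- rewrite !Rmult_1_l, exp_Ropp; f_equal; field; split; lra.
- replace (-1 * ang c (t s)) with (- ang c (t s)) by ring.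
  rewrite exp_Ropp; f_equal; field; repeat split; lra.
Qed.

End ShrinkerInvariants.

Lemma shrinker_const_quantity (X : R -> pt) (l r : Rbar) :
  shrinker X l r -> const_quantity X l r.
Proof.
intros H; destruct (shrinker_first_integral X l r H) as [c0 Hc0].
exists (c0 ^ 2); intros s Hs; rewrite <- (Hc0 s Hs), Rpow_mult_distr; f_equal.
simpl; rewrite Rmult_1_r, <- exp_plus; f_equal; field.
Qed.

Lemma asymptotic_to_cone_ext (X Y : R -> pt) (l r : Rbar) :
  (forall s, in_ivl l r s -> X s = Y s) -> asymptotic_to_cone Y l r -> asymptotic_to_cone X l r.
Proof.
intros E [p [v1 [v2 [Hv [[L1 L2] [R1 R2]]]]]].
assert (WR : forall P : pt -> Prop,
  (exists s1, in_ivl l r s1 /\ forall s, in_ivl s1 r s -> P (Y s)) ->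
  exists s1, in_ivl l r s1 /\ forall s, in_ivl s1 r s -> P (X s)).
{ intros P [s1 [Hs1 H]]; exists s1; split; [assumption|]; intros s Hs; rewrite E; auto.
  split; [apply (Rbar_lt_trans _ s1); [apply Hs1|apply Hs]|apply Hs]. }
assert (WL : forall P : pt -> Prop,
  (exists s1, in_ivl l r s1 /\ forall s, in_ivl l s1 s -> P (Y s)) ->
  exists s1, in_ivl l r s1 /\ forall s, in_ivl l s1 s -> P (X s)).
{ intros P [s1 [Hs1 H]]; exists s1; split; [assumption|]; intros s Hs; rewrite E; auto.
  split; [apply Hs|apply (Rbar_lt_trans _ s1); [apply Hs|apply Hs1]]. }
exists p, v1, v2; repeat split; auto.
- intros M; apply (WL (fun q => M < enorm q)), L1.
- intros e He; apply (WL (fun q => near_ray p v1 q e)), L2, He.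
- intros M; apply (WR (fun q => M < enorm q)), R1.
- intros e He; apply (WR (fun q => near_ray p v2 q e)), R2, He.
Qed.

(** A zero first integral means zero curvature, hence a line. Otherwise [X] is a piece of a
    transported model curve, maximality makes it the whole of it, and the inverse isometry carries
    it to the model. *)
Lemma max_shrinker_classification (X : R -> pt) (l r : Rbar) :
  max_shrinker X l r -> ~ on_line X l r ->
  convex_curve X l r /\ asymptotic_to_cone X l r /\
  exists c, congruent X l r (curve c) (- smax c) (smax c).
Proof.
intros [HX Hmax] Hline.
destruct (shrinker_first_integral X l r HX) as [c0 Hc0].
assert (Hne : c0 <> 0).
{ intros ->; apply Hline, shrinker_flat_on_line; [assumption|].
  intros s Hs; specialize (Hc0 s Hs); apply Rmult_integral in Hc0.
  destruct Hc0 as [|He]; [assumption|]. apply Rgt_not_eq in He; [easy|apply exp_pos]. }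
destruct (shrinker_classification X l r HX c0 Hne Hc0) as [b [C [c [d [HC Heq]]]]].
destruct (shrinker_lmap_curve b C c d HC) as [HY _].
destruct (in_ivl_bounds l r (- smax c - d) (smax c - d)) as [Hl Hr].
{ apply HX. }
{ intros s Hs; destruct (Heq s Hs); lra. }
destruct (Hmax _ _ _ HY Hl Hr) as [<- <-].
{ intros s Hs; symmetry; apply Heq, Hs. }
split; [|split].
- destruct (Rdichotomy _ _ Hne); [right|left]; intros s Hs; specialize (Hc0 s Hs);
    pose proof (exp_pos (- mink (X s) (X s) / 2)); nra.
- apply (asymptotic_to_cone_ext _ (fun s => lmap b C (curve c (s + d)))).
  + intros s Hs; apply Heq, Hs.
  + apply asymptotic_to_cone_lmap, curve_asymptotic; assumption.
- exists c, (lmap b (if b then / C else C)); split; [|split].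
  + apply lmap_lorentz; destruct b; [now apply Rinv_neq_0_compat|assumption].
  + intros s Hs; exists (s - d).
    assert (Hs' : in_ivl (- smax c - d) (smax c - d) (s - d))
      by (apply in_ivl_shift; now replace (s - d + d) with s by ring).
    split; [assumption|].
    rewrite (proj2 (Heq (s - d) Hs')), lmap_inv by assumption.
    now replace (s - d + d) with s by ring.
  + intros s Hs; exists (s + d); split.
    * now apply in_ivl_shift.
    * now rewrite (proj2 (Heq s Hs)), lmap_inv.
Qed.

(** * Behaviour under the flow *)

Lemma curve_symmetric (c : R) : symmetric_y_axis (curve c) (- smax c) (smax c).
Proof.
intros s Hs; exists (- s); split; [unfold in_ivl in *; simpl in *; lra|now apply curve_opp].
Qed.

(** Symmetry would make the line horizontal, so [xi - eta] would be constant; but [xi] is unbounded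
    above and [eta] is bounded above. *)
Lemma curve_not_on_line (c : R) : ~ on_line (curve c) (- smax c) (smax c).
Proof.
intros [q [v [Hv H]]].
set (D := eta v * xi q - xi v * eta q).
assert (HD : forall u, eta v * xi_profile c u - xi v * eta_profile c u = D).
{ intros u; destruct (H (arc c u)) as [a Ha]; [split; [apply arc_gt_opp_smax|apply arc_lt_smax]|].
  rewrite <- (xi_lc (xi_profile c u) (eta_profile c u)) at 1.
  rewrite <- (eta_lc (xi_profile c u) (eta_profile c u)) at 2.
  unfold curve in Ha; rewrite tau_arc in Ha; rewrite Ha.
  unfold D, padd, pscal, xi, eta; simpl; ring. }
pose proof (HD 0) as H0; rewrite xi_profile_0, eta_profile_0 in H0.
(* Subtracting the reflected relation forces [eta v = xi v]: the line is horizontal. *)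
assert (Hm : eta v = xi v).
{ pose proof (HD 1) as H1; pose proof (HD (Ropp 1)) as H2.
  rewrite xi_profile_opp, eta_profile_opp in H2.
  pose proof (xi_profile_increasing c 0 1 Rlt_0_1) as H3.
  pose proof (eta_profile_increasing c 0 1 Rlt_0_1) as H4.
  rewrite xi_profile_0 in H3; rewrite eta_profile_0 in H4.
  assert (Hz : (eta v - xi v) * (xi_profile c 1 + eta_profile c 1) = 0) by lra.
  apply Rmult_integral in Hz; lra. }
assert (Hm0 : xi v <> 0).
{ intros E; apply Hv; rewrite <- (lc_xi_eta v), Hm, E; unfold lc; f_equal; field. }
destruct (xi_profile_unbounded c (kappa c + smax c)) as [m [_ Hun]].
specialize (Hun (m + 1)); specialize (HD (m + 1)).
assert (Hlt : kappa c + smax c < xi_profile c (m + 1)) by (apply Hun; lra).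
pose proof (eta_profile_le c (m + 1)); pose proof (kappa_pos c).
rewrite Hm in H0, HD.
assert (E : xi v * (xi_profile c (m + 1) - eta_profile c (m + 1) + 2 * kappa c) = 0) by lra.
apply Rmult_integral in E; lra.
Qed.

Lemma enorm_pscal (a : R) (q : pt) : enorm (pscal a q) = Rabs a * enorm q.
Proof.
unfold enorm, pscal; simpl fst; simpl snd.
rewrite <- sqrt_Rsqr_abs, <- sqrt_mult_alt by apply Rle_0_sqr.
f_equal; unfold Rsqr; ring.
Qed.

(** On the right half [eta >= kappa c], on the left half [- xi >= kappa c]; the curve thus stays
    away from the origin, and scaling up sends all of it to infinity. *)
Lemma enorm_curve_ge (c s : R) : kappa c / 2 <= enorm (curve c s).
Proof.
destruct (Rle_lt_dec 0 (tau c s)) as [H|H].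
- pose proof (abs_eta_le_enorm (curve c s)) as He; unfold curve in He at 1; rewrite eta_lc in He.
  apply (eta_profile_ge c) in H; pose proof (Rle_abs (eta_profile c (tau c s))); lra.
- pose proof (abs_xi_le_enorm (curve c s)) as He; unfold curve in He at 1; rewrite xi_lc in He.
  assert (H' : 0 <= - tau c s) by lra; apply (eta_profile_ge c) in H'.
  rewrite eta_profile_opp in H'.
  pose proof (Rle_abs (- xi_profile c (tau c s))) as Ha; rewrite Rabs_Ropp in Ha; lra.
Qed.

Lemma curve_from_infinity (c : R) : from_infinity (curve c) (- smax c) (smax c).
Proof.
(* [A] is the scaling that brings the lower bound [kappa c / 2] up to [|M|]; for [t < - A^2/2] the
   factor [sqrt (1 - 2 t)] exceeds it. *)
intros M; set (A := Rabs M / (kappa c / 2)); exists (- (A ^ 2) / 2); intros t Ht s _.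
pose proof (kappa_pos c) as Hk; pose proof (enorm_curve_ge c s) as He.
pose proof (Rabs_pos M) as HM.
assert (HA : 0 <= A) by (apply Rdiv_le_0_compat; lra).
unfold flow; rewrite enorm_pscal, Rabs_pos_eq by apply sqrt_pos.
assert (Hs : A < sqrt (1 - 2 * t)).
{ rewrite <- (sqrt_pow2 A) by assumption; apply sqrt_lt_1_alt; split; [apply pow2_ge_0|lra]. }
assert (HAM : A * (kappa c / 2) = Rabs M) by (unfold A; field; lra).
pose proof (Rle_abs M); nra.
Qed.

Lemma sqrt_scale_small (eps : R) : 0 < eps ->
  exists d, 0 < d /\ forall t, 1 / 2 - d < t < 1 / 2 -> 0 < sqrt (1 - 2 * t) < eps.
Proof.
intros He; exists (eps ^ 2 / 2); split; [nra|]; intros t Ht.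
split; [apply sqrt_lt_R0; lra|].
rewrite <- (sqrt_pow2 eps) by lra; apply sqrt_lt_1_alt; lra.
Qed.

Lemma flow_lc (c t s : R) :
  flow (curve c) t s =
  lc (sqrt (1 - 2 * t) * xi_profile c (tau c s)) (sqrt (1 - 2 * t) * eta_profile c (tau c s)).
Proof. unfold flow, curve, pscal, lc; simpl; f_equal; field. Qed.

Lemma flow_opp (c t s : R) : - smax c < s < smax c ->
  flow (curve c) t (- s) = reflect (flow (curve c) t s).
Proof.
intros Hs; unfold flow; rewrite curve_opp by assumption.
unfold pscal, reflect; simpl; f_equal; ring.
Qed.

Lemma reflect_involutive (q : pt) : reflect (reflect q) = q.
Proof. destruct q; unfold reflect; simpl; f_equal; ring. Qed.

Lemma light_cone_halves_reflect (q : pt) : light_cone_halves q -> light_cone_halves (reflect q).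
Proof. unfold light_cone_halves, reflect, xi, eta; simpl; lra. Qed.

Lemma enorm_psub_reflect (p q : pt) : enorm (psub (reflect p) (reflect q)) = enorm (psub p q).
Proof.
rewrite <- (enorm_reflect (psub p q)); f_equal.
unfold psub, reflect; simpl; f_equal; ring.
Qed.

Lemma psub_lc (u v u' v' : R) : psub (lc u v) (lc u' v') = lc (u - u') (v - v').
Proof. unfold psub, lc; simpl; f_equal; field. Qed.

(** The point with [xi = x / a] is scaled by [a] exactly to [xi = x], and its [eta] is at most
    [a * B]. *)
Lemma flow_reaches_xi_axis (c x eps : R) : 0 < x -> 0 < eps -> exists d, 0 < d /\
  forall t, 1 / 2 - d < t < 1 / 2 -> exists s, in_ivl (- smax c) (smax c) s /\
    enorm (psub (flow (curve c) t s) (lc x 0)) < eps.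
Proof.
intros Hx He; set (B := kappa c + smax c).
pose proof (kappa_pos c) as Hk; pose proof (smax_pos c) as HS.
destruct (sqrt_scale_small (eps / B)) as [d [Hd Ht]]; [apply Rdiv_lt_0_compat; unfold B; lra|].
exists d; split; [assumption|]; intros t Htd; specialize (Ht t Htd).
set (a := sqrt (1 - 2 * t)) in *.
destruct (xi_profile_onto c (x / a)) as [u [Hu Hxu]]; [apply Rdiv_lt_0_compat; lra|].
exists (arc c u); split; [split; [apply arc_gt_opp_smax|apply arc_lt_smax]|].
rewrite flow_lc, tau_arc, psub_lc, Hxu; fold a.
replace (a * (x / a) - x) with 0 by (field; lra).
eapply Rle_lt_trans; [apply enorm_lc_le|].
rewrite Rabs_R0, Rplus_0_l, Rminus_0_r.
pose proof (eta_profile_le c u); apply (eta_profile_ge c) in Hu.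
rewrite Rabs_pos_eq by nra.
apply (Rle_lt_trans _ (a * B)); [unfold B; nra|].
replace eps with (eps / B * B) by (field; unfold B; lra).
apply Rmult_lt_compat_r; [unfold B|]; lra.
Qed.

Lemma flow_near_xi_axis (c eps : R) : 0 < eps -> exists d, 0 < d /\
  forall t, 1 / 2 - d < t < 1 / 2 -> forall s, 0 <= tau c s ->
    exists q, light_cone_halves q /\ enorm (psub (flow (curve c) t s) q) < eps.
Proof.
intros He; set (B := kappa c + smax c).
pose proof (kappa_pos c) as Hk; pose proof (smax_pos c) as HS.
destruct (sqrt_scale_small (eps / (B + B + 1))) as [d [Hd Ht]];
  [apply Rdiv_lt_0_compat; unfold B; lra|].
exists d; split; [assumption|]; intros t Htd s Hs; specialize (Ht t Htd).
rewrite flow_lc; set (a := sqrt (1 - 2 * t)) in *.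
set (x := xi_profile c (tau c s)); set (y := eta_profile c (tau c s)).
assert (Hx : - kappa c <= x) by now apply xi_profile_ge.
assert (Hy : kappa c <= y) by now apply eta_profile_ge.
assert (HyB : y <= B) by apply eta_profile_le.
(* The axis is an open ray, so where [x < 1] the point [xi = a] is used; [x >= - kappa c] bounds the
   displacement by [a * (B + 1)], and [eta] adds at most [a * B]. *)
exists (lc (a * Rmax x 1) 0); split.
- left; rewrite xi_lc, eta_lc; split; [reflexivity|].
  pose proof (Rmax_r x 1); nra.
- rewrite psub_lc, Rminus_0_r; eapply Rle_lt_trans; [apply enorm_lc_le|].
  rewrite <- Rmult_minus_distr_l, !Rabs_mult, (Rabs_pos_eq a), (Rabs_pos_eq y) by lra.
  assert (Hd1 : Rabs (x - Rmax x 1) <= B + 1).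
  { unfold B; apply Rabs_le; unfold Rmax; destruct Rle_dec; lra. }
  apply (Rle_lt_trans _ (a * (B + B + 1))); [nra|].
  replace eps with (eps / (B + B + 1) * (B + B + 1)) by (field; unfold B; lra).
  apply Rmult_lt_compat_r; [unfold B|]; lra.
Qed.

Lemma curve_contracts_to (c : R) : contracts_to (curve c) (- smax c) (smax c) light_cone_halves.
Proof.
split.
- intros q [[H1 H2]|[H1 H2]] eps He.
  + destruct (flow_reaches_xi_axis c (xi q) eps H2 He) as [d [Hd H]].
    exists d; split; [assumption|]; rewrite <- H1, lc_xi_eta in H; exact H.
  + destruct (flow_reaches_xi_axis c (- eta q) eps) as [d [Hd H]]; [lra|assumption|].
    exists d; split; [assumption|]; intros t Ht.
    destruct (H t Ht) as [s [Hs Hn]]; exists (- s); split.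
    * unfold in_ivl in *; simpl in *; lra.
    * rewrite flow_opp, <- (reflect_involutive q), enorm_psub_reflect by assumption.
      replace (reflect q) with (lc (- eta q) 0); [assumption|].
      rewrite <- (lc_xi_eta q), H1; unfold reflect, lc, eta; simpl; f_equal; field.
- intros M eps He; destruct (flow_near_xi_axis c eps He) as [d [Hd H]].
  exists d; split; [assumption|]; intros t Ht s Hs _.
  destruct (Rle_lt_dec 0 (tau c s)) as [Hu|Hu]; [now apply H|].
  destruct (H t Ht (- s)) as [q [Hq Hn]]; [rewrite tau_opp by exact Hs; lra|].
  exists (reflect q); split; [now apply light_cone_halves_reflect|].
  rewrite flow_opp in Hn by exact Hs.
  now rewrite <- enorm_psub_reflect, reflect_involutive.
Qed.

(** * Distinct parameters give non-congruent curves *)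

(** The vertex of [curve c'] is the image of a point of [curve c], so [- kappa c' ^ 2] is at least
    the minimum [- kappa c ^ 2] of [<X,X>] there. *)
Lemma congruent_curve_le (c c' : R) :
  congruent (curve c) (- smax c) (smax c) (curve c') (- smax c') (smax c') -> c' <= c.
Proof.
intros [L [HL [H _]]].
destruct (H 0) as [s [_ Hs]]; [pose proof (smax_pos c'); split; simpl; lra|].
pose proof (mink_curve_vertex c') as Hv; rewrite Hs, HL in Hv.
pose proof (mink_curve_ge c s); pose proof (kappa_pos c); pose proof (kappa_pos c').
apply Rnot_lt_le; intros Hlt; apply kappa_increasing in Hlt; nra.
Qed.

Lemma congruent_curve_ge (c c' : R) :
  congruent (curve c) (- smax c) (smax c) (curve c') (- smax c') (smax c') -> c <= c'.
Proof.
intros [L [HL [_ H]]].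
destruct (H 0) as [s [_ Hs]]; [pose proof (smax_pos c); split; simpl; lra|].
pose proof (mink_curve_vertex c) as Hv; rewrite <- HL, <- Hs in Hv.
pose proof (mink_curve_ge c' s); pose proof (kappa_pos c); pose proof (kappa_pos c').
apply Rnot_lt_le; intros Hlt; apply kappa_increasing in Hlt; nra.
Qed.

(** * Continuity of the family *)

Lemma continuous_curv_pair (z : R * R) : continuous (fun z : R * R => curv (fst z) (snd z)) z.
Proof.
apply (continuous_comp (fun z : R * R => fst z + snd z ^ 2 / 2) kappa).
- apply (continuous_plus (fun z : R * R => fst z) (fun z : R * R => snd z ^ 2 / 2));
    [apply continuous_fst|].
  apply (continuous_comp snd (fun u => u ^ 2 / 2)); [apply continuous_snd|].
  apply (ex_derive_continuous (fun u => u ^ 2 / 2)); auto_derive; trivial.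
- apply (ex_derive_continuous kappa); eexists; apply is_derive_kappa.
Qed.

Lemma Rabs_Rdiv_le (x y D : R) : 0 < D -> Rabs y <= D -> Rabs (x * y / D) <= Rabs x.
Proof.
intros HD Hy; unfold Rdiv.
rewrite !Rabs_mult, (Rabs_pos_eq (/ D)) by (left; now apply Rinv_0_lt_compat).
apply (Rmult_le_reg_r D); [assumption|].
rewrite Rmult_assoc, Rinv_l, Rmult_1_r by lra.
pose proof (Rabs_pos x); nra.
Qed.

Lemma arc_rate_lipschitz (x y : R) : Rabs (/ (1 + x ^ 2) - / (1 + y ^ 2)) <= Rabs (x - y).
Proof.
pose proof (one_plus_sqr_pos x); pose proof (one_plus_sqr_pos y).
replace (/ (1 + x ^ 2) - / (1 + y ^ 2)) with ((x - y) * (- (x + y)) / ((1 + x ^ 2) * (1 + y ^ 2)))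
  by (field; split; lra).
(* These squares give [|x| <= x^2 + 1/4] and [|y| <= y^2 + 1/4], so [|x + y|] is below the
   denominator. *)
pose proof (pow2_ge_0 (x - / 2)); pose proof (pow2_ge_0 (x + / 2)).
pose proof (pow2_ge_0 (y - / 2)); pose proof (pow2_ge_0 (y + / 2)).
pose proof (pow2_ge_0 (x * y)).
apply Rabs_Rdiv_le; [nra|]; apply Rabs_le; split; lra.
Qed.

Lemma ang_rate_lipschitz (x y : R) : Rabs (x / (1 + x ^ 2) - y / (1 + y ^ 2)) <= Rabs (x - y).
Proof.
pose proof (one_plus_sqr_pos x); pose proof (one_plus_sqr_pos y).
replace (x / (1 + x ^ 2) - y / (1 + y ^ 2)) with ((x - y) * (1 - x * y) / ((1 + x ^ 2) * (1 + y ^ 2)))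
  by (field; split; lra).
pose proof (pow2_ge_0 (x - y)); pose proof (pow2_ge_0 (x + y)).
pose proof (pow2_ge_0 (x * y)); pose proof (pow2_ge_0 x); pose proof (pow2_ge_0 y).
apply Rabs_Rdiv_le; [nra|]; apply Rabs_le; split; lra.
Qed.

(** Uniform in [u] because [c] enters the argument of the 1-Lipschitz [kappa] additively. *)
Lemma uniformly_close (phi : R -> R) (c0 eps : R) :
  (forall x y, Rabs (phi x - phi y) <= Rabs (x - y)) -> 0 < eps ->
  locally c0 (fun c => forall u, Rabs (phi (curv c u) - phi (curv c0 u)) <= eps).
Proof.
intros Hphi He; exists (mkposreal eps He); intros c Hc u.
change (Rabs (c - c0) < eps) in Hc.
eapply Rle_trans; [apply Hphi|]; unfold curv.
eapply Rle_trans; [apply kappa_lipschitz|].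
replace (c + u ^ 2 / 2 - (c0 + u ^ 2 / 2)) with (c - c0) by ring; lra.
Qed.

Lemma continuous_arc_pair (z : R * R) : continuous (fun z : R * R => arc (fst z) (snd z)) z.
Proof.
destruct z as [c u]; apply (continuous_primitive_param arc_rate).
- exact continuous_arc_rate.
- intros a x; unfold arc_rate.
  rewrite Rabs_pos_eq by (left; apply Rinv_0_lt_compat, one_plus_sqr_pos).
  rewrite <- Rinv_1; apply Rinv_le_contravar; [lra|]. pose proof (pow2_ge_0 (curv a x)); lra.
- intros eps He; now apply (uniformly_close (fun x => / (1 + x ^ 2))); [apply arc_rate_lipschitz|].
Qed.

Lemma continuous_ang_pair (z : R * R) : continuous (fun z : R * R => ang (fst z) (snd z)) z.
Proof.
destruct z as [c u]; apply (continuous_primitive_param ang_rate).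
- exact continuous_ang_rate.
- intros a x; unfold ang_rate.
  rewrite <- (Rmult_1_l (curv a x)) at 1; apply (Rle_trans _ (Rabs 1)); [|rewrite Rabs_R1; lra].
  apply Rabs_Rdiv_le; [apply one_plus_sqr_pos|].
  pose proof (curv_pos a x); rewrite Rabs_pos_eq by lra; nra.
- intros eps He; now apply (uniformly_close (fun x => x / (1 + x ^ 2))); [apply ang_rate_lipschitz|].
Qed.

Lemma locally_arc_between (c0 s0 u1 u2 : R) : arc c0 u1 < s0 < arc c0 u2 ->
  locally (c0, s0) (fun z : R * R => arc (fst z) u1 < snd z < arc (fst z) u2).
Proof.
intros [H1 H2].
assert (Hc : forall w, continuous (fun z : R * R => arc (fst z) w - snd z) (c0, s0)).
{ intros w; apply (continuous_minus (fun z : R * R => arc (fst z) w) (fun z : R * R => snd z));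
    [|apply continuous_snd].
  apply (continuous_comp_2 fst (fun _ => w) arc);
    [apply continuous_fst|apply continuous_const|apply continuous_arc_pair]. }
assert (L1 : locally (c0, s0) (fun z : R * R => arc (fst z) u1 - snd z < 0)).
{ apply (Hc u1 (fun y => y < 0)), open_lt; simpl; lra. }
assert (L2 : locally (c0, s0) (fun z : R * R => 0 < arc (fst z) u2 - snd z)).
{ apply (Hc u2 (fun y => 0 < y)), open_gt; simpl; lra. }
generalize (filter_and _ _ L1 L2); apply filter_imp; intros z [Ha Hb]; lra.
Qed.

(** The domain varies with [c] through a supremum; bracketing [s0 = arc c0 u] by [arc c (u - 1)] and
    [arc c (u + 1)], which are continuous in [c], gives openness. *)
Lemma locally_in_domain (c0 s0 : R) : - smax c0 < s0 < smax c0 ->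
  locally (c0, s0) (fun z : R * R => - smax (fst z) < snd z < smax (fst z)).
Proof.
intros Hs; destruct (arc_onto c0 s0 Hs) as [u <-].
apply (filter_imp (fun z : R * R => arc (fst z) (u - 1) < snd z < arc (fst z) (u + 1))).
- intros z Hz; pose proof (arc_gt_opp_smax (fst z) (u - 1)).
  pose proof (arc_lt_smax (fst z) (u + 1)); lra.
- apply locally_arc_between; split; apply arc_increasing; lra.
Qed.

(** The same bracketing with [u - e] and [u + e]: by monotonicity of [arc c] the preimage of a
    nearby [s] stays between them. *)
Lemma continuous_tau_pair (c0 s0 : R) : - smax c0 < s0 < smax c0 ->
  continuous (fun z : R * R => tau (fst z) (snd z)) (c0, s0).
Proof.
intros Hs; apply filterlim_locally; intros [e He]; simpl.
destruct (arc_onto c0 s0 Hs) as [u <-]; rewrite tau_arc.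
assert (L : locally (c0, arc c0 u)
  (fun z : R * R => arc (fst z) (u - e) < snd z < arc (fst z) (u + e)))
  by (apply locally_arc_between; split; apply arc_increasing; lra).
generalize (filter_and _ _ L (locally_in_domain c0 (arc c0 u) Hs)).
apply filter_imp; intros [c s]; simpl; intros [Hz Hd].
destruct (arc_onto c s Hd) as [w <-]; rewrite tau_arc.
change (Rabs (w - u) < e); apply Rabs_def1.
- assert (w < u + e) by (apply (increasing_lt_inv _ (arc_increasing c)); lra); lra.
- assert (u - e < w) by (apply (increasing_lt_inv _ (arc_increasing c)); lra); lra.
Qed.

Lemma continuous_exp_R (x : R) : continuous exp x.
Proof. apply (ex_derive_continuous exp); eexists; apply is_derive_exp. Qed.

Lemma continuous_xi_profile_pair (z : R * R) :
  continuous (fun z : R * R => xi_profile (fst z) (snd z)) z.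
Proof.
apply (continuous_mult (fun z : R * R => snd z - curv (fst z) (snd z))
  (fun z : R * R => exp (ang (fst z) (snd z)))).
- apply (continuous_minus (fun z : R * R => snd z) (fun z : R * R => curv (fst z) (snd z)));
    [apply continuous_snd|apply continuous_curv_pair].
- apply (continuous_comp (fun z : R * R => ang (fst z) (snd z)) exp);
    [apply continuous_ang_pair|apply continuous_exp_R].
Qed.

Lemma continuous_eta_profile_pair (z : R * R) :
  continuous (fun z : R * R => eta_profile (fst z) (snd z)) z.
Proof.
apply (continuous_mult (fun z : R * R => snd z + curv (fst z) (snd z))
  (fun z : R * R => exp (- ang (fst z) (snd z)))).
- apply (continuous_plus (fun z : R * R => snd z) (fun z : R * R => curv (fst z) (snd z)));
    [apply continuous_snd|apply continuous_curv_pair].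
- apply (continuous_comp (fun z : R * R => - ang (fst z) (snd z)) exp);
    [|apply continuous_exp_R].
  apply (continuous_opp (fun z : R * R => ang (fst z) (snd z))), continuous_ang_pair.
Qed.

Lemma curve_continuous (c0 s0 : R) : - smax c0 < s0 < smax c0 -> forall eps, 0 < eps ->
  locally (c0, s0) (fun z : R * R => enorm (psub (curve (fst z) (snd z)) (curve c0 s0)) < eps).
Proof.
intros Hs eps He.
pose proof (continuous_tau_pair c0 s0 Hs) as Ht.
assert (C1 : continuous (fun z : R * R => xi_profile (fst z) (tau (fst z) (snd z))) (c0, s0))
  by (apply (continuous_comp_2 fst (fun z : R * R => tau (fst z) (snd z)) xi_profile);
      [apply continuous_fst|exact Ht|apply continuous_xi_profile_pair]).
assert (C2 : continuous (fun z : R * R => eta_profile (fst z) (tau (fst z) (snd z))) (c0, s0))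
  by (apply (continuous_comp_2 fst (fun z : R * R => tau (fst z) (snd z)) eta_profile);
      [apply continuous_fst|exact Ht|apply continuous_eta_profile_pair]).
assert (He2 : 0 < eps / 2) by lra.
apply (proj1 (filterlim_locally _ _)) with (eps := mkposreal _ He2) in C1.
apply (proj1 (filterlim_locally _ _)) with (eps := mkposreal _ He2) in C2.
generalize (filter_and _ _ C1 C2); apply filter_imp; intros [c s] [H1 H2].
change (Rabs (xi_profile c (tau c s) - xi_profile c0 (tau c0 s0)) < eps / 2) in H1.
change (Rabs (eta_profile c (tau c s) - eta_profile c0 (tau c0 s0)) < eps / 2) in H2.
unfold curve; simpl fst; simpl snd; rewrite psub_lc.
eapply Rle_lt_trans; [apply enorm_lc_le|]; lra.
Qed.

Theorem theorem7p1 :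
  exists (p0 q0 : Rbar) (G : R -> R -> pt) (lo hi : R -> Rbar),
    Rbar_lt p0 q0 /\
    (* each member of the family *)
    (forall a, in_ivl p0 q0 a ->
       max_shrinker (G a) (lo a) (hi a) /\ ~ on_line (G a) (lo a) (hi a) /\
       convex_curve (G a) (lo a) (hi a) /\
       asymptotic_to_cone (G a) (lo a) (hi a) /\
       symmetric_y_axis (G a) (lo a) (hi a) /\
       const_quantity (G a) (lo a) (hi a) /\
       from_infinity (G a) (lo a) (hi a) /\
       contracts_to (G a) (lo a) (hi a) light_cone_halves) /\
    (* distinct parameters give non-congruent curves *)
    (forall a b, in_ivl p0 q0 a -> in_ivl p0 q0 b ->
       congruent (G a) (lo a) (hi a) (G b) (lo b) (hi b) -> a = b) /\
    (* the family depends continuously on the parameter *)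
    (forall a0 s0, in_ivl p0 q0 a0 -> in_ivl (lo a0) (hi a0) s0 ->
       forall eps, 0 < eps -> exists d, 0 < d /\
         forall a s, Rabs (a - a0) < d -> Rabs (s - s0) < d ->
           in_ivl p0 q0 a /\ in_ivl (lo a) (hi a) s /\
           enorm (psub (G a s) (G a0 s0)) < eps) /\
    (* every space-like non-straight shrinker is, up to isometry, in the family *)
    (forall (X : R -> pt) (l r : Rbar),
       max_shrinker X l r -> ~ on_line X l r ->
       convex_curve X l r /\ asymptotic_to_cone X l r /\ const_quantity X l r /\
       exists a, in_ivl p0 q0 a /\ congruent X l r (G a) (lo a) (hi a)).
Proof.
(* The parameter [c], the logarithm of the first integral, ranges over the whole line. *)
exists m_infty, p_infty, curve, (fun c => Finite (- smax c)), (fun c => Finite (smax c)).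
split; [exact I|split; [|split; [|split]]].
- intros c _.
  repeat match goal with |- _ /\ _ => split end.
  + apply curve_max_shrinker.
  + apply curve_not_on_line.
  + apply curve_convex.
  + apply curve_asymptotic.
  + apply curve_symmetric.
  + apply shrinker_const_quantity, shrinker_curve.
  + apply curve_from_infinity.
  + apply curve_contracts_to.
- intros a b _ _ H; apply Rle_antisym; [now apply congruent_curve_ge|now apply congruent_curve_le].
- intros a0 s0 _ Hs eps He.
  destruct (filter_and _ _ (curve_continuous a0 s0 Hs eps He) (locally_in_domain a0 s0 Hs))
    as [[d Hd] H].
  exists d; split; [assumption|]; intros a s Ha Hsd.
  destruct (H (a, s)) as [H1 H2]; [split; assumption|].
  split; [split; exact I|split; [exact H2|exact H1]].
- intros X l r HX Hline.
  destruct (max_shrinker_classification X l r HX Hline) as [H1 [H2 [c Hc]]].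
  split; [assumption|split; [assumption|split]].
  + apply shrinker_const_quantity, HX.
  + exists c; split; [split; exact I|assumption].
Qed.
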